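(* Let $A\in\mathbb M(n)$, $1\le k\le n$, let $A=U|A|$ be a polar decomposition of $A$, and let $\mathscr W$ be a (complex linear) subspace of $\mathbb M(n)$. If there exist density matrices $P_1,\dots,P_k\in\mathbb M(n)$ such that $\|\sum_{i=1}^kP_i\|_\infty\le1$, $|A|P_i=s_i(A)P_i$ for $1\le i\le k$, and $U\sum_{i=1}^kP_i\in\mathscr W^\perp$, then $A$ is orthogonal to $\mathscr W$ in $\|\cdot\|_{(k)}$, i.e. $\|A+W\|_{(k)}\ge\|A\|_{(k)}$ for all $W\in\mathscr W$. If $s_k(A)>0$, then the converse also holds.
   Context: $\mathbb M(n)$ is the space of $n\times n$ complex matrices with inner product $\langle X,Y\rangle=\operatorname{tr}(X^*Y)$; $\mathscr W^\perp$ is the orthogonal complement of $\mathscr W$ with respect to this inner product. A density matrix is a positive semidefinite matrix of trace $1$. $U$ is unitary and $|A|=(A^*A)^{1/2}$. $s_1(A)\ge\dots\ge s_n(A)$ are the singular values of $A$, $\|A\|_{(k)}=s_1(A)+\dots+s_k(A)$ is the Ky Fan $k$-norm, and $\|X\|_\infty=s_1(X)$ is the operator norm. *)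

(* Defs.v *)
(* Complex numbers are modelled by an arbitrary
   numClosedFieldType C (algebraically closed field with conjugation and
   the induced order on reals), as in mathcomp's spectral.v. *)
From HB Require Import structures.
From mathcomp Require Import all_boot all_order all_algebra.
Set Implicit Arguments. Unset Strict Implicit. Unset Printing Implicit Defensive.
Import Order.TTheory GRing.Theory Num.Theory.
Local Open Scope ring_scope.
Local Open Scope sesquilinear_scope.

Section Defs.
Context {C : numClosedFieldType} {n : nat}.

(* conjugate transpose X^* *)
Definition adjmx (X : 'M[C]_n) : 'M[C]_n := X ^t*.

(* Hilbert-Schmidt inner product <X,Y> = tr(X^* Y) *)
Definition hs_inner (X Y : 'M[C]_n) : C := \tr (adjmx X *m Y).

(* positive semidefinite: Hermitian with nonnegative quadratic form *)
Definition psdmx (X : 'M[C]_n) : Prop :=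
  adjmx X = X /\ forall v : 'rV[C]_n, 0 <= (v *m X *m v ^t*) 0 0.

(* density matrix: psd with trace 1 *)
Definition density (X : 'M[C]_n) : Prop := psdmx X /\ \tr X = 1.

(* A = U P is a polar decomposition: U unitary, P = |A| = (A^*A)^{1/2}
   (the unique psd square root of A^*A) *)
Definition polar_decomp (A U P : 'M[C]_n) : Prop :=
  U \is unitarymx /\ psdmx P /\ P *m P = adjmx A *m A /\ A = U *m P.

(* singular values, in nonincreasing order: square roots of the
   eigenvalues (with multiplicity) of A^*A, sorted decreasingly *)
Definition sv_seq (A : 'M[C]_n) : seq C :=
  sort (fun x y : C => y <= x)
    [seq sqrtC (spectral_diag (adjmx A *m A) 0 i) | i <- enum 'I_n].

(* sv A i = s_{i+1}(A)  (0-based index) *)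
Definition sv (A : 'M[C]_n) (i : nat) : C := nth 0 (sv_seq A) i.

(* Ky Fan k-norm *)
Definition kyfan (k : nat) (A : 'M[C]_n) : C := \sum_(i < k) sv A i.

(* operator norm = largest singular value *)
Definition opnorm (X : 'M[C]_n) : C := sv X 0.

(* X in the orthogonal complement of W *)
Definition in_orth (W : {vspace 'M[C]_n}) (X : 'M[C]_n) : Prop :=
  forall Y, Y \in W -> hs_inner X Y = 0.

(* A orthogonal to W in the Ky Fan k-norm *)
Definition kf_orth (k : nat) (A : 'M[C]_n) (W : {vspace 'M[C]_n}) : Prop :=
  forall Y, Y \in W -> kyfan k A <= kyfan k (A + Y).

End Defs.

(* Main.v *)
(** A density certificate P yields the functional X |-> tr ((U sum_i P_i)^* X),
which vanishes on W, takes the value ||A||_(k) at A, and is bounded by the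
Ky Fan norm: writing X = S^* diag(s) V, the trace is sum_i s_i b_i with
|b_i| <= 1 and sum_i |b_i| <= k.

Conversely, a Hahn-Banach extension gives T in the orthogonal complement of W
with Re tr (T^* X) <= ||X||_(k) for all X and equality at A.  In an eigenbasis
of |A|, testing U^* T against signed diagonal matrices, rank-one matrices and
the unitaries 1 - (1 - w) x^* x shows that it is positive semidefinite, bounded
by 1, of trace k, the identity on the eigenspaces of |A| above s_k(A) and zero
on those below; cutting it along the eigenspaces gives the P_i.

The real elements of C need not be order complete.  They form a real closed
field, and each cut arising in a one-step Hahn-Banach extension is definable
in it (the Ky Fan norm is described by polynomial equations in a singular
value decomposition), so quantifier elimination provides the supremum. *)

Require Import Defs.
From Stdlib Require Import Classical.
From HB Require Import structures.
From mathcomp Require Import all_boot all_order all_fingroup all_algebra.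
From mathcomp Require Import ring zify.
From mathcomp Require Import polyrcf ordered_qelim qe_rcf.
Import Order.TTheory GRing.Theory Num.Theory.
Local Open Scope ring_scope.
Local Open Scope sesquilinear_scope.
Set Implicit Arguments. Unset Strict Implicit. Unset Printing Implicit Defensive.

(** * Real closedness of the real elements of an algebraically closed field *)

Section RealPart.
Variables (C : numClosedFieldType) (R : realFieldType) (f : {rmorphism R -> C}).
Hypothesis f_real : forall x, f x \is Num.real.
Hypothesis f_ge0 : forall x, (0 <= f x) = (0 <= x).
Hypothesis f_onto : forall z, z \is Num.real -> exists x, f x = z.

(* Nonreal roots come in conjugate pairs, whose quadratic factors are positive. *)
Lemma poly_constant_sign (p : {poly R}) (a b : R) : a <= b ->
  (forall x, a <= x <= b -> ~~ root p x) -> 0 < p.[a] * p.[b].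
Proof.
move=> leab; elim: (size p).+1 {-2}p (leqnn (size p).+1) => // m IH {}p.
rewrite ltnS => szp noroot.
have p0 : p != 0.
  apply: contraNneq (noroot a _) => [->|]; first by rewrite root0.
  by rewrite lexx leab.
have [sz1|sz1] := eqVneq (size p) 1%N.
  have /size_poly1P[c c0 ->] : size p == 1%N by rewrite sz1.
  by rewrite !hornerC -expr2 exprn_even_gt0.
have [r rootr] : exists r, root (map_poly f p) r.
  by apply/closed_rootP; rewrite size_map_poly.
have [rreal|rnreal] := boolP (r \is Num.real).
  have [r' r'E] := f_onto rreal.
  have /factor_theorem[q qE] : root p r'  by rewrite -(fmorph_root f) r'E.
  have q0 : q != 0 by apply: contraNneq p0 => q0; rewrite qE q0 mul0r.
  have szq : (size q < m)%N.
    by move: szp; rewrite qE size_Mmonic ?monicXsubC // size_XsubC addn2.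
  have qab : 0 < q.[a] * q.[b].
    by apply: IH => // x /noroot; apply: contra; rewrite qE rootM => ->.
  rewrite qE !hornerM !hornerXsubC mulrACA pmulr_rgt0 //.
  have r'p : root p r' by rewrite qE rootM root_XsubC eqxx orbT.
  case: (ltP r' a) => [lra|lar].
    by rewrite mulr_gt0 ?subr_gt0 //; exact: lt_le_trans leab.
  case: (ltP b r') => [lbr|lbr]; last by have := noroot r'; rewrite lar lbr r'p => /(_ isT).
  by rewrite nmulr_rgt0 ?subr_lt0 //; exact: le_lt_trans lbr.
have cr : r^* != r by apply: contraNneq rnreal => /CrealP.
have [s sE] : exists s, f s = r + r^*.
  by apply/f_onto/CrealP; rewrite rmorphD /= conjCK addrC.
have [t tE] : exists t, f t = r * r^*.
  by apply/f_onto/CrealP; rewrite rmorphM /= conjCK mulrC.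
pose q : {poly R} := 'X^2 - s%:P * 'X + t%:P.
have qE : map_poly f q = ('X - r%:P) * ('X - r^*%:P).
  rewrite /q rmorphD rmorphB /= map_polyXn rmorphM /= map_polyX !map_polyC /=.
  by rewrite sE tE polyCD polyCM; ring.
have rootrc : root (map_poly f p) r^*.
  have := rootr; rewrite /root => /eqP/(congr1 (@Num.conj C)).
  rewrite rmorph0 -horner_map /= -map_poly_comp => /eqP h.
  congr (is_true (_ == _)) : h; congr _.[_].
  by apply: eq_map_poly => x /=; apply/CrealP/f_real.
have qdvd : q %| p.
  rewrite -(dvdp_map f) qE Gauss_dvdp; last first.
    by rewrite coprimep_XsubC root_XsubC // eq_sym.
  by rewrite !dvdp_XsubCl rootr rootrc.
have qpos x : 0 < q.[x].
  have fq : f q.[x] = `|f x - r| ^+ 2.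
    by rewrite -horner_map qE hornerM !hornerXsubC normCK rmorphB /= (CrealP (f_real x)).
  have fr : f x - r != 0.
    by apply: contraNneq rnreal => /eqP; rewrite subr_eq0 => /eqP <-.
  by rewrite lt_def -f_ge0 -(fmorph_eq0 f) fq exprn_ge0 // expf_eq0 normr_eq0 (negbTE fr).
have /dvdpP[p' pE] := qdvd.
have p'0 : p' != 0 by apply: contraNneq p0 => q0; rewrite pE q0 mul0r.
have szq : size q = 3%N.
  by rewrite -(size_map_poly f) qE size_Mmonic ?monicXsubC ?polyXsubC_eq0 // !size_XsubC.
have szp' : (size p' < m)%N.
  by move: szp; rewrite pE size_mul // -?size_poly_eq0 ?szq // addn3 /= => /ltnW.
have p'ab : 0 < p'.[a] * p'.[b].
  by apply: IH => // x /noroot; apply: contra; rewrite pE rootM => ->.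
by rewrite pE !hornerM mulrACA pmulr_lgt0 // mulr_gt0.
Qed.

Lemma real_part_closed : Num.real_closed_axiom R.
Proof.
move=> p a b leab /andP[pa pb].
have [[x [xab px]]|no_root] := classic (exists x, a <= x <= b /\ root p x).
  by exists x.
suff h : forall x, a <= x <= b -> ~~ root p x.
  by have := poly_constant_sign leab h; rewrite ltNge mulr_le0_ge0.
by move=> x xab; apply/negP => px; apply: no_root; exists x.
Qed.
End RealPart.

(** * The real elements of [C] as a real closed field *)

Section RealSubfield.
Variable C : numClosedFieldType.

(** Being real is only a predicate on [C]; quantifier elimination needs a type carrying a real
    closed field structure. *)
Record realsub := RealSub { realval : C; _ : realval \is Num.real }.
HB.instance Definition _ := [isSub for realval].
HB.instance Definition _ := [Choice of realsub by <:].
HB.instance Definition _ := [SubChoice_isSubIntegralDomain of realsub by <:].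
HB.instance Definition _ := [SubIntegralDomain_isSubField of realsub by <:].

Definition realsub_le (x y : realsub) := realval x <= realval y.
Definition realsub_lt (x y : realsub) := realval x < realval y.
Lemma realsub_norm_subproof (x : realsub) : `|realval x| \is Num.real.
Proof. exact: normr_real. Qed.
Definition realsub_norm x := RealSub (realsub_norm_subproof x).
Lemma realval_real (x : realsub) : realval x \is Num.real.
Proof. by case: x. Qed.

Lemma realval0 : realval 0 = 0.
Proof. exact: (raddf0 (val : realsub -> C)). Qed.
Lemma realvalD x y : realval (x + y) = realval x + realval y.
Proof. exact: (raddfD (val : realsub -> C)). Qed.
Lemma realvalN x : realval (- x) = - realval x.
Proof. exact: (raddfN (val : realsub -> C)). Qed.
Lemma realvalM x y : realval (x * y) = realval x * realval y.
Proof. exact: (rmorphM (val : realsub -> C)). Qed.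
Lemma realsub_le0_add x y : realsub_le 0 x -> realsub_le 0 y -> realsub_le 0 (x + y).
Proof. by rewrite /realsub_le realval0 realvalD; exact: addr_ge0. Qed.
Lemma realsub_le0_mul x y : realsub_le 0 x -> realsub_le 0 y -> realsub_le 0 (x * y).
Proof. by rewrite /realsub_le realval0 realvalM; exact: mulr_ge0. Qed.
Lemma realsub_le0_anti x : realsub_le 0 x -> realsub_le x 0 -> x = 0.
Proof.
rewrite /realsub_le realval0 => h1 h2; apply: val_inj; apply/eqP.
by rewrite /= [X in _ == X]realval0 eq_le h1 h2.
Qed.
Lemma realsub_sub_ge0 x y : realsub_le 0 (y - x) = realsub_le x y.
Proof. by rewrite /realsub_le realval0 realvalD realvalN subr_ge0. Qed.
Lemma realsub_le0_total x : realsub_le 0 x || realsub_le x 0.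
Proof. rewrite /realsub_le realval0; exact: realval_real. Qed.
Lemma realsub_normN x : realsub_norm (- x) = realsub_norm x.
Proof. by apply: val_inj; rewrite -[LHS]/(`|realval (- x)|) realvalN normrN. Qed.
Lemma realsub_ge0_norm x : realsub_le 0 x -> realsub_norm x = x.
Proof. by rewrite /realsub_le realval0 => h; apply: val_inj; rewrite /= ger0_norm. Qed.
Lemma realsub_lt_def x y : realsub_lt x y = (y != x) && realsub_le x y.
Proof. by rewrite /realsub_lt /realsub_le lt_def. Qed.
HB.instance Definition _ := Num.IntegralDomain_isLeReal.Build realsub
  realsub_le0_add realsub_le0_mul realsub_le0_anti realsub_sub_ge0
  realsub_le0_total realsub_normN realsub_ge0_norm realsub_lt_def.
HB.instance Definition _ := GRing.RMorphism.copy realval (val : realsub -> C).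

Lemma le_realval (x y : realsub) : (x <= y) = (realval x <= realval y).
Proof. by []. Qed.
Lemma realval_ge0 (x : realsub) : (0 <= realval x) = (0 <= x).
Proof. by rewrite le_realval rmorph0. Qed.

Lemma realval_onto z : z \is Num.real -> exists x : realsub, realval x = z.
Proof. by move=> zr; exists (RealSub zr). Qed.

HB.instance Definition _ := Num.RealField_isClosed.Build realsub
  (real_part_closed realval_real realval_ge0 realval_onto).

End RealSubfield.

(** * Suprema of definable cuts by quantifier elimination *)

Section DefinableCuts.
Variable F : rcfType.

Lemma rterm_poly (t : GRing.term F) : GRing.rterm t ->
  exists p : {poly F}, forall x, GRing.eval [:: x] t = p.[x].
Proof.
elim: t => //=.
(* Only variable 0 is assigned; every other variable reads the default value 0. *)
- case=> [|i] _; first by exists 'X => x; rewrite hornerX.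
  by exists 0 => x; rewrite horner0 /= nth_default.
- by move=> c _; exists c%:P => x; rewrite hornerC.
- by move=> n _; exists n%:R => x; rewrite hornerMn hornerC.
- move=> t IHt u IHu /andP[/IHt[p pE] /IHu[q qE]].
  by exists (p + q) => x; rewrite hornerD pE qE.
- by move=> t IHt /IHt[p pE]; exists (- p) => x; rewrite hornerN pE.
- by move=> t IHt n /IHt[p pE]; exists (p *+ n) => x; rewrite hornerMn pE.
- move=> t IHt u IHu /andP[/IHt[p pE] /IHu[q qE]].
  by exists (p * q) => x; rewrite hornerM pE qE.
- by move=> t IHt n /IHt[p pE]; exists (p ^+ n) => x; rewrite horner_exp pE.
Qed.

(** Piecewise constancy with finitely many break points [rs], phrased by endpoints so that it also
    makes sense for Boolean values. *)
Definition constant_off (T : Type) (rs : seq F) (phi : F -> T) :=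
  forall a b, a <= b -> (forall r, r \in rs -> ~~ (a <= r <= b)) -> phi a = phi b.

(** The break points are the roots of the polynomial: by the intermediate value theorem its sign
    cannot change between them. *)
Lemma rterm_sg (t : GRing.term F) : GRing.rterm t ->
  exists rs, constant_off rs (fun x => Num.sg (GRing.eval [:: x] t)).
Proof.
move=> /rterm_poly[p pE]; have [p0|p0] := eqVneq p 0.
  by exists [::] => a b _ _; rewrite !pE p0 !horner0.
exists (rootsR p) => a b ab nor; rewrite !pE.
have nr x : a <= x <= b -> ~~ root p x.
  move=> xab; apply/negP => px.
  have /nor : x \in rootsR p by rewrite -(roots_on_rootsR p0) in_itv.
  by rewrite xab.
have pa0 : p.[a] != 0 by apply: nr; rewrite lexx ab.
have pb0 : p.[b] != 0 by apply: nr; rewrite lexx ab.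
have [h|h] := leP (p.[a] * p.[b]) 0; last first.
  case: (ltgtP p.[a] 0) h pa0 => [ha|ha|->]; rewrite ?eqxx //.
    by rewrite nmulr_rgt0 // => hb; rewrite !ltr0_sg.
  by rewrite pmulr_rgt0 // => hb; rewrite !gtr0_sg.
have [x xab] := polyrcf.poly_ivt ab h.
by rewrite in_itv in xab; apply/contraTeq => _; exact: nr.
Qed.

(** An atom depends only on the sign of the difference of its two terms, and a connective merges the
    break points of its arguments. *)
Lemma qf_formula_constant_off (f : ord.formula F) : ord.qf_form f -> ord.rformula f ->
  exists rs, constant_off rs (fun x => ord.qf_eval [:: x] f).
Proof.
have off_cat T U (rs rs' : seq F) (phi : F -> T) (psi : F -> U) :
    constant_off rs phi -> constant_off rs' psi ->
    constant_off (rs ++ rs') phi /\ constant_off (rs ++ rs') psi.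
  move=> h h'; split=> a b ab nor; [apply: h|apply: h'] => // r rrs;
    by apply: nor; rewrite mem_cat rrs ?orbT.
have off2 (T U V : Type) (g : T -> U -> V) (phi : F -> T) (psi : F -> U) :
    (exists rs, constant_off rs phi) -> (exists rs, constant_off rs psi) ->
    exists rs, constant_off rs (fun x => g (phi x) (psi x)).
  move=> [rs h] [rs' h']; exists (rs ++ rs').
  have [{}h {}h'] := off_cat _ _ _ _ _ _ h h'.
  by move=> a b ab nor; rewrite (h a b) ?(h' a b).
have offsg (g : F -> bool) (t : GRing.term F) : GRing.rterm t ->
    exists rs, constant_off rs (fun x => g (Num.sg (GRing.eval [:: x] t))).
  by move=> /rterm_sg[rs h]; exists rs => a b ab nor; rewrite (h a b).
elim: f => //=.
- by move=> b _ _; exists [::].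
- move=> t u _ /andP[rt ru].
  have [|rs h] := offsg (fun s => s == 0) (GRing.Add t (GRing.Opp u)).
    by rewrite /= rt ru.
  exists rs => a b ab nor; move: (h a b ab nor) => /=.
  by rewrite !sgr_eq0 !subr_eq0.
- move=> t u _ /andP[rt ru].
  have [|rs h] := offsg (fun s => s < 0) (GRing.Add t (GRing.Opp u)).
    by rewrite /= rt ru.
  exists rs => a b ab nor; move: (h a b ab nor) => /=.
  by rewrite !sgr_lt0 !subr_lt0.
- move=> t u _ /andP[rt ru].
  have [|rs h] := offsg (fun s => s <= 0) (GRing.Add t (GRing.Opp u)).
    by rewrite /= rt ru.
  exists rs => a b ab nor; move: (h a b ab nor) => /=.
  by rewrite !sgr_le0 !subr_le0.
- move=> f IHf g IHg /andP[/IHf{}IHf /IHg{}IHg] /andP[/IHf{}IHf /IHg{}IHg].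
  exact: off2.
- move=> f IHf g IHg /andP[/IHf{}IHf /IHg{}IHg] /andP[/IHf{}IHf /IHg{}IHg].
  exact: off2.
- move=> f IHf g IHg /andP[/IHf{}IHf /IHg{}IHg] /andP[/IHf{}IHf /IHg{}IHg].
  exact: off2.
- move=> f IHf qf rf; case: (IHf qf rf) => rs h.
  by exists rs => a b ab nor; rewrite (h a b).
Qed.

(** [rcf_sat] evaluates the quantifier-free formula that elimination produces, so the previous case
    applies. *)
Lemma formula_constant_off (f : ord.formula F) :
  exists rs, constant_off rs (fun x => rcf_sat [:: x] f).
Proof.
have /andP[] := ord.quantifier_elim_wf (@wf_QE_wproj F) (ord.to_rform_rformula f).
exact: qf_formula_constant_off.
Qed.

(** Otherwise the interval from [a] to [b] can be shrunk past one break point after the other: if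
    [phi] holds beyond [r], the left end moves there; if it fails before [r], the right end does; in
    the remaining case [r] is the supremum. An interval without break points cannot straddle the
    cut. *)
Lemma cut_sup (phi : F -> bool) (rs : seq F) (a b : F) :
  constant_off rs phi -> (forall x y, x <= y -> phi y -> phi x) ->
  phi a -> ~~ phi b ->
  exists s, (forall x, phi x -> x <= s) /\ (forall x, x < s -> phi x).
Proof.
move=> off down pa pb; apply: NNPP => nosup.
suff [a' [b' [pa' [pb' nor]]]] : exists a' b', phi a' /\ ~~ phi b' /\
    forall r, r \in rs -> ~~ (a' <= r <= b').
  have lab : a' <= b'.
    by rewrite leNgt; apply: contra pb' => /ltW /down /(_ pa').
  by move: pb'; rewrite -(off a' b') ?pa'.
elim: rs {off} => [|r rs [a' [b' [pa' [pb' nor]]]]]; first by exists a, b.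
have lt_phi x y : phi x -> ~~ phi y -> x < y.
  by move=> px py; rewrite ltNge; apply: contra py => /down /(_ px).
have [[x px rx]|no_gt] := classic (exists2 x, phi x & r < x).
  exists (Num.max x a'), b'; split; first by rewrite /Num.max; case: ifP.
  split=> // q; rewrite inE => /predU1P[->|/nor].
    by rewrite ge_max (leNgt x) rx.
  by apply: contra; rewrite ge_max => /andP[/andP[_ ->] ->].
have [[y py ry]|no_lt] := classic (exists2 y, ~~ phi y & y < r).
  exists a', (Num.min y b'); split=> //; split; first by rewrite /Num.min; case: ifP.
  move=> q; rewrite inE => /predU1P[->|/nor].
    by rewrite le_min (leNgt r) ry andbF.
  by apply: contra; rewrite le_min => /andP[-> /andP[_ ->]].
case: nosup; exists r; split=> x.
  by move=> px; rewrite leNgt; apply/negP => rx; apply: no_gt; exists x.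
by move=> xr; apply/negPn/negP => px; apply: no_lt; exists x.
Qed.

End DefinableCuts.

(** * First-order definability of complex polynomial and matrix equations *)

Section Definable.
Variables (C : numClosedFieldType) (F : rcfType) (f : {rmorphism F -> C}).
Hypothesis f_real : forall x, f x \is Num.real.
Variable I : finType.
Implicit Types (g h : F -> (I -> F) -> C) (P Q : F -> (I -> F) -> Prop).

(** Variable 0 is the parameter of the cut; the unknowns follow from variable 1 on and will be
    quantified. *)
Definition real_env (c : F) (x : I -> F) : seq F := c :: [seq x i | i <- enum I].

(** The two terms are the real and imaginary parts; this makes conjugation available although
    formulas speak of [F] only. *)
Definition polyfun g := exists t u : GRing.term F, forall c x,
  g c x = f (GRing.eval (real_env c x) t) + 'i * f (GRing.eval (real_env c x) u).

Definition definable P := exists phi : ord.formula F, forall c x,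
  P c x <-> ord.holds (real_env c x) phi.

Lemma polyfun_ext g h : (forall c x, g c x = h c x) -> polyfun g -> polyfun h.
Proof. by move=> gh [t [u tu]]; exists t, u => c x; rewrite -gh. Qed.

Lemma polyfun_const z a b : z = f a + 'i * f b -> polyfun (fun _ _ => z).
Proof. by move=> ->; exists (GRing.Const a), (GRing.Const b). Qed.

Lemma polyfun_param : polyfun (fun c _ => f c).
Proof.
exists (GRing.Var _ 0), (GRing.Const 0) => c x /=.
by rewrite rmorph0 mulr0 addr0.
Qed.

Lemma polyfun_var i : polyfun (fun _ x => f (x i)).
Proof.
exists (GRing.Var _ (enum_rank i).+1), (GRing.Const 0) => c x /=.
rewrite rmorph0 mulr0 addr0 (nth_map i) -?cardE ?ltn_ord //.
by rewrite -[X in nth _ _ X]/(nat_of_ord _) nth_enum_rank.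
Qed.

Lemma polyfunD g h : polyfun g -> polyfun h -> polyfun (fun c x => g c x + h c x).
Proof.
move=> [t [u gE]] [t' [u' hE]]; exists (GRing.Add t t'), (GRing.Add u u') => c x.
by rewrite gE hE /= !rmorphD; ring.
Qed.

Lemma polyfunN g : polyfun g -> polyfun (fun c x => - g c x).
Proof.
move=> [t [u gE]]; exists (GRing.Opp t), (GRing.Opp u) => c x.
by rewrite gE /= !rmorphN; ring.
Qed.

Lemma polyfunM g h : polyfun g -> polyfun h -> polyfun (fun c x => g c x * h c x).
Proof.
move=> [t [u gE]] [t' [u' hE]].
exists (GRing.Add (GRing.Mul t t') (GRing.Opp (GRing.Mul u u'))).
exists (GRing.Add (GRing.Mul t u') (GRing.Mul u t')) => c x.
have i2 : 'i * 'i = -1 :> C by rewrite -expr2 sqrCi.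
by rewrite gE hE /= !(rmorphD, rmorphB, rmorphN, rmorphM); ring: i2.
Qed.

Lemma polyfun_conj g : polyfun g -> polyfun (fun c x => (g c x)^*).
Proof.
move=> [t [u gE]]; exists t, (GRing.Opp u) => c x.
rewrite gE rmorphD rmorphM /= conjCi rmorphN mulrN mulNr.
by rewrite !(CrealP (f_real _)).
Qed.

Lemma polyfun_sum (J : Type) (r : seq J) (p : pred J) (g : J -> F -> (I -> F) -> C) :
  (forall j, polyfun (g j)) -> polyfun (fun c x => \sum_(j <- r | p j) g j c x).
Proof.
move=> pg; elim: r => [|j r IH].
  apply: (polyfun_ext (g := fun _ _ => 0)) => [c x|]; first by rewrite big_nil.
  by apply: (@polyfun_const _ 0 0); rewrite rmorph0 mulr0 addr0.
case pj : (p j); last first.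
  by apply: polyfun_ext IH => c x; rewrite big_cons pj.
by apply: polyfun_ext (polyfunD (pg j) IH) => c x; rewrite big_cons pj.
Qed.

Lemma definable_eq g h : polyfun g -> polyfun h -> definable (fun c x => g c x = h c x).
Proof.
move=> pg ph; have [t [u tu]] := polyfunD pg (polyfunN ph).
exists (ord.And (ord.Equal t (GRing.Const 0)) (ord.Equal u (GRing.Const 0))) => c x.
split=> /= [gh|[t0 u0]]; last first.
  by apply/eqP; rewrite -subr_eq0 tu t0 u0 rmorph0 mulr0 addr0.
have := tu c x; rewrite gh subrr => /esym tu0.
have [/eqP] : f (GRing.eval (real_env c x) t) = 0 /\ f (GRing.eval (real_env c x) u) = 0.
  have := congr1 (fun z => 'Re z) tu0; have := congr1 (fun z => 'Im z) tu0.
  by rewrite Re_rect ?Im_rect //= !raddf0.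
by rewrite fmorph_eq0 => /eqP-> /eqP; rewrite fmorph_eq0 => /eqP->.
Qed.

Lemma definable_and P Q : definable P -> definable Q ->
  definable (fun c x => P c x /\ Q c x).
Proof.
move=> [phi phiE] [psi psiE]; exists (ord.And phi psi) => c x.
by rewrite /= phiE psiE.
Qed.

Lemma definable_forall (J : finType) (P : J -> F -> (I -> F) -> Prop) :
  (forall j, definable (P j)) -> definable (fun c x => forall j, P j c x).
Proof.
move=> dP; have /fin_all_exists [phi phiE] := dP.
exists (foldr (fun j => ord.And (phi j)) (ord.Bool true) (enum J)) => c x.
have : (forall j, P j c x) <-> forall j, j \in enum J -> P j c x.
  by split=> h j => [_|]; [exact: h|apply: h; rewrite mem_enum].
move=> ->; elim: (enum J) => [|j s IH] /=; first by split.
rewrite -IH -phiE; split=> [h|[h h'] k].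
  by split=> [|k ks]; apply: h; rewrite inE ?eqxx ?ks ?orbT.
by rewrite inE => /predU1P[->|/h'].
Qed.

Lemma definable_eqmx m n (A B : F -> (I -> F) -> 'M[C]_(m, n)) :
  (forall i j, polyfun (fun c x => A c x i j)) ->
  (forall i j, polyfun (fun c x => B c x i j)) ->
  definable (fun c x => A c x = B c x).
Proof.
move=> pA pB; have [phi phiE] : definable (fun c x =>
    forall k : 'I_m * 'I_n, A c x k.1 k.2 = B c x k.1 k.2).
  by apply: definable_forall => k; apply: definable_eq.
exists phi => c x; rewrite -phiE; split=> [->//|h].
by apply/matrixP => i j; apply: (h (i, j)).
Qed.

Lemma polyfun_mulmx m n p (A : F -> (I -> F) -> 'M[C]_(m, n))
    (B : F -> (I -> F) -> 'M[C]_(n, p)) :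
  (forall i j, polyfun (fun c x => A c x i j)) ->
  (forall i j, polyfun (fun c x => B c x i j)) ->
  forall i j, polyfun (fun c x => (A c x *m B c x) i j).
Proof.
move=> pA pB i j; apply: polyfun_ext (_ : polyfun (fun c x => \sum_k A c x i k * B c x k j)).
  by move=> c x; rewrite mxE.
by apply: polyfun_sum => k; apply: polyfunM.
Qed.

(** Quantifying the variable numbered [size e] writes just behind the end of the environment, hence
    appends a value. *)
Lemma holds_exists_iota (phi : ord.formula F) m (e : seq F) :
  ord.holds e (foldr (fun k => ord.Exists k) phi (iota (size e) m)) <->
  exists2 x : seq F, size x = m & ord.holds (e ++ x) phi.
Proof.
elim: m e => [|m IH] e /=.
  split=> [h|[[|//] _]]; last by rewrite cats0.
  by exists [::]; rewrite ?cats0.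
have set_last x : set_nth 0 e (size e) x = rcons e x.
  by elim: e {IH} => //= a e ->.
split=> [[x]|[[//|x y] [szy] h]].
  rewrite set_last -(size_rcons e x) => /IH[y szy h].
  by exists (x :: y) => //=; rewrite ?szy // -cat_rcons.
exists x; rewrite set_last -(size_rcons e x); apply/IH.
by exists y => //; rewrite cat_rcons.
Qed.

(** Quantifying the unknowns away leaves a one-variable formula that is downward closed, to which
    [cut_sup] applies. *)
Lemma definable_sup P : definable P ->
  (forall a b, a <= b -> (exists x, P b x) -> exists x, P a x) ->
  (exists a x, P a x) -> (exists b, forall c x, P c x -> c <= b) ->
  exists s, (forall c x, P c x -> c <= s) /\
            (forall b, (forall c x, P c x -> c <= b) -> s <= b).
Proof.
move=> [phi phiE] down [a Pa] [b Pb].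
pose psi := foldr (fun k => ord.Exists k) phi (iota 1 #|I|).
have psiE c : reflect (exists x, P c x) (rcf_sat [:: c] psi).
  apply: (iffP (rcf_satP _ _)); rewrite /psi -[1%N]/(size [:: c]) holds_exists_iota.
    move=> [y szy h]; exists (fun i => nth 0 y (enum_rank i)); apply/phiE.
    suff e : [seq nth 0 y (enum_rank i) | i <- enum I] = y by rewrite /real_env e.
    apply: (@eq_from_nth _ 0) => [|k]; rewrite size_map -cardE //.
    move=> ltk; rewrite -[k]/(val (Ordinal ltk)).
    rewrite (nth_map (enum_val (Ordinal ltk))) -?cardE //.
    by rewrite -enum_val_nth enum_valK.
  move=> [x /phiE]; exists [seq x i | i <- enum I] => //.
  by rewrite size_map -cardE.
have [rs off] := formula_constant_off psi.
have psi_down x y : x <= y -> rcf_sat [:: y] psi -> rcf_sat [:: x] psi.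
  by move=> xy /psiE h; apply/psiE; apply: down h.
have psi_a : rcf_sat [:: a] psi by apply/psiE.
(* The bound [b] itself may be attained, so a point strictly above it is taken. *)
have psi_b : ~~ rcf_sat [:: b + 1] psi.
  by apply/psiE => -[x /Pb]; rewrite leNgt ltrDl ltr01.
have [s [s1 s2]] := cut_sup off psi_down psi_a psi_b.
exists s; split=> [c x Pc|b' Pb']; first by apply: s1; apply/psiE; exists x.
rewrite leNgt; apply/negP => b's.
have [m /andP[b'm ms]] : exists m, b' < m < s.
  by exists ((b' + s) / 2); rewrite !midf_lt.
by have /psiE[x /Pb'] := s2 _ ms; rewrite leNgt b'm.
Qed.

End Definable.

(** * Unitary matrices and the dual unit ball *)

Section UnitaryMatrices.
Variable C : numClosedFieldType.

Lemma trmxC_mul m n p (A : 'M[C]_(m, n)) (B : 'M[C]_(n, p)) :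
  (A *m B)^t* = B^t* *m A^t*.
Proof. by rewrite trmx_mul map_mxM. Qed.

Lemma sqnormE n (x : 'rV[C]_n) : (x *m x^t*) 0 0 = \sum_j `|x 0 j| ^+ 2.
Proof. by rewrite mxE; apply: eq_bigr => j _; rewrite !mxE normCK. Qed.

Lemma sqnorm_ge0 n (x : 'rV[C]_n) : 0 <= (x *m x^t*) 0 0.
Proof. by rewrite sqnormE sumr_ge0 // => j _; rewrite exprn_ge0. Qed.

Lemma sqnorm_eq0 n (x : 'rV[C]_n) : ((x *m x^t*) 0 0 == 0) = (x == 0).
Proof.
apply/idP/eqP => [|->]; last by rewrite mul0mx mxE.
rewrite sqnormE psumr_eq0 => [/allP x0|j _]; last by rewrite exprn_ge0.
apply/rowP => j; have := x0 j (mem_index_enum j).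
by rewrite expf_eq0 /= normr_eq0 mxE => /eqP.
Qed.

Lemma unitarymxV n (V : 'M[C]_n) : V \is unitarymx -> V^t* *m V = 1%:M.
Proof. by move=> Vu; apply: mulmx1C; apply/unitarymxP. Qed.

Lemma sqnorm_unitary n (x : 'rV[C]_n) (V : 'M[C]_n) : V \is unitarymx ->
  x *m V *m (x *m V)^t* = x *m x^t*.
Proof. by move=> Vu; rewrite trmxC_mul mulmxA mulmxtVK. Qed.

Lemma sqnorm_row_unitary n (V : 'M[C]_n) i : V \is unitarymx ->
  (row i V *m (row i V)^t*) 0 0 = 1.
Proof. by move=> /row_unitarymxP/(_ i i); rewrite dotmxE eqxx. Qed.

Lemma unitary_row_sum n (V : 'M[C]_n) i : V \is unitarymx ->
  \sum_j `|V i j| ^+ 2 = 1.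
Proof.
move=> /(sqnorm_row_unitary i); rewrite sqnormE => <-.
by apply: eq_bigr => j _; rewrite mxE.
Qed.

Lemma unitary_col_sum n (V : 'M[C]_n) j : V \is unitarymx ->
  \sum_i `|V i j| ^+ 2 = 1.
Proof.
rewrite -trmx_unitary => /(unitary_row_sum j) <-.
by apply: eq_bigr => i _; rewrite mxE.
Qed.

Lemma normM_le_mean (a b : C) : `|a * b| <= (`|a| ^+ 2 + `|b| ^+ 2) / 2.
Proof.
rewrite normrM -subr_ge0.
have -> : (`|a| ^+ 2 + `|b| ^+ 2) / 2 - `|a| * `|b| = (`|a| - `|b|) ^+ 2 / 2 by field.
by rewrite divr_ge0 ?ler0n // -realEsqr rpredB // normr_real.
Qed.

Lemma mul_diag_entry m n p (A : 'M[C]_(m, n)) (d : 'rV[C]_n) (B : 'M[C]_(n, p)) i j :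
  (A *m diag_mx d *m B) i j = \sum_l d 0 l * (A i l * B l j).
Proof.
by rewrite mxE; apply: eq_bigr => l _; rewrite mul_mx_diag mxE mulrAC mulrC.
Qed.

(* The unit ball of the norm dual to the Ky Fan k-norm. *)
Definition dual_ball n (k : nat) (M : 'M[C]_n) : Prop :=
  (forall x y : 'rV[C]_n, (x *m x^t*) 0 0 = 1 -> (y *m y^t*) 0 0 = 1 ->
     `|(x *m M *m y^t*) 0 0| <= 1) /\
  (forall R S : 'M[C]_n, R \is unitarymx -> S \is unitarymx ->
     \sum_i `|(R *m M *m S) i i| <= k%:R).

Lemma dual_ball_mul n k (M G H : 'M[C]_n) : G \is unitarymx -> H \is unitarymx ->
  dual_ball k M -> dual_ball k (G *m M *m H).
Proof.
move=> Gu Hu [M1 M2]; split=> [x y x1 y1|R S Ru Su].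
  have := M1 (x *m G) (y *m H^t*); rewrite !sqnorm_unitary ?trmxC_unitary //.
  by rewrite trmxC_mul trmxCK !mulmxA => ->.
have := M2 (R *m G) (H *m S); rewrite !mulmxA => -> //; exact: mul_unitarymx.
Qed.

(** Products of entries are bounded by the mean of their squared moduli, and the squared moduli in a
    row or column of a unitary matrix add up to 1. *)
Lemma dual_ball_diag n k (l : 'rV[C]_n) : (forall j, 0 <= l 0 j <= 1) ->
  \sum_j l 0 j <= k%:R -> dual_ball k (diag_mx l).
Proof.
move=> l01 lk; have l_ge0 j : 0 <= l 0 j by case/andP: (l01 j).
have term (a b : C) j : `|l 0 j * (a * b)| <= l 0 j * ((`|a| ^+ 2 + `|b| ^+ 2) / 2).
  by rewrite normrM ger0_norm // ler_wpM2l // normM_le_mean.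
split=> [x y x1 y1|R S Ru Su].
  rewrite mul_diag_entry; apply: le_trans (ler_norm_sum _ _ _) _.
  apply: (@le_trans _ _ (\sum_j (`|x 0 j| ^+ 2 + `|y 0 j| ^+ 2) / 2)).
    apply: ler_sum => j _; apply: le_trans (term _ _ _) _.
    rewrite !mxE norm_conjC ler_piMl ?divr_ge0 ?addr_ge0 ?exprn_ge0 //.
    by case/andP: (l01 j).
  by rewrite -mulr_suml big_split /= -!sqnormE x1 y1 -[1 + 1]/(2%:R) divff ?pnatr_eq0.
apply: le_trans lk.
apply: (@le_trans _ _ (\sum_i \sum_j l 0 j * ((`|R i j| ^+ 2 + `|S j i| ^+ 2) / 2))).
  apply: ler_sum => i _; rewrite mul_diag_entry.
  by apply: le_trans (ler_norm_sum _ _ _) _; apply: ler_sum.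
rewrite exchange_big; apply: ler_sum => j _ /=.
rewrite -mulr_sumr -mulr_suml big_split /=.
by rewrite (unitary_col_sum j Ru) (unitary_row_sum j Su) -[1 + 1]/(2%:R) divff ?pnatr_eq0 ?mulr1.
Qed.

(** Subtract the threshold [t = d (k - 1)]: the differences [d i - t] are nonnegative for [i < k]
    and nonpositive afterwards, so the weights 1 and 0 are the best ones, while [t] multiplies a
    total weight of at most [k]. *)
Lemma weighted_sum_le n k (d b : nat -> C) : (1 <= k <= n)%N ->
  (forall i j, (i <= j < n)%N -> d j <= d i) -> (forall i, (i < n)%N -> 0 <= d i) ->
  (forall i, (i < n)%N -> 0 <= b i <= 1) -> \sum_(i < n) b i <= k%:R ->
  \sum_(i < n) d i * b i <= \sum_(i < k) d i.
Proof.
move=> /andP[k1 kn] dd d0 b01 bk; pose t := d k.-1.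
have kn' : (k.-1 < n)%N by lia.
have split_t : \sum_(i < n) d i * b i =
    \sum_(i < n) (d i - t) * b i + t * \sum_(i < n) b i.
  by rewrite mulr_sumr -big_split; apply: eq_bigr => i _ /=; ring.
have -> : \sum_(i < k) d i = \sum_(i < k) (d i - t) + t * k%:R.
  by rewrite big_split /= sumr_const card_ord -[- t *+ k]mulr_natr mulNr addrNK.
rewrite split_t lerD ?ler_wpM2l ?d0 //.
rewrite (big_ord_widen _ (fun i => d i - t) kn) [leRHS]big_mkcond.
apply: ler_sum => i _; have /andP[b0 b1] := b01 i (ltn_ord i).
case: ifP => ik.
  by rewrite ler_piMr // subr_ge0 dd //; lia.
by rewrite mulr_le0_ge0 // subr_le0 dd //; have := ltn_ord i; lia.
Qed.

End UnitaryMatrices.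

(** * Spectral and singular value decompositions *)

Section SingularValues.
Variables (C : numClosedFieldType) (n : nat).
Implicit Types (A X V S R : 'M[C]_n).

Lemma mulmx_row_entry V X S i j :
  (V *m X *m S^t*) i j = (row i V *m X *m (row j S)^t*) 0 0.
Proof.
by rewrite -row_mul !mxE; apply: eq_bigr => l _; rewrite !mxE.
Qed.

Lemma psd_spectral X (d := spectral_diag X) : psdmx X -> exists V,
  [/\ V \is unitarymx, forall i, 0 <= d 0 i & X = V^t* *m diag_mx d *m V].
Proof.
move=> [Xh Xpos]; have Xn : X \is normalmx.
  by apply/normalmxP; move: Xh; rewrite /adjmx => ->.
have Vu := spectral_unitarymx X; have /orthomx_spectralP := Xn.
rewrite invmx_unitary // -/d; set V := spectralmx X in Vu * => XE.
exists V; split=> // i; have := Xpos (row i V).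
rewrite -mulmx_row_entry {1}XE !mulmxA (unitarymxP Vu) mul1mx mulmxtVK //.
by rewrite mxE eqxx mulr1n.
Qed.

Lemma gram_psd A : psdmx (adjmx A *m A).
Proof.
split; first by rewrite /adjmx trmxC_mul trmxCK.
move=> v; have := sqnorm_ge0 (v *m A^t*).
by rewrite trmxC_mul trmxCK !mulmxA.
Qed.

(** Induction on the number of rows outside [P]: a unit vector orthogonal to all prescribed rows
    fills one of them. *)
Lemma orthonormal_completion (P : pred 'I_n) (M : 'M[C]_n) :
  (forall i j, P i -> P j -> (row i M *m (row j M)^t*) 0 0 = (i == j)%:R) ->
  exists2 S, S \is unitarymx & forall i, P i -> row i S = row i M.
Proof.
elim: {P}_.+1 {-2}P (ltnSn #|predC P|) M => // m IH P ltPm M orthM.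
have [i0 Pi0|/= allP] := pickP (predC P); last first.
  exists M => //; apply/row_unitarymxP => i j; rewrite dotmxE orthM //.
    by move: (allP i) => /= /negbFE.
  by move: (allP j) => /= /negbFE.
(* The zero row [i0] makes this matrix singular; a kernel vector of its adjoint is orthogonal to the
   rows in [P]. *)
pose M' := \matrix_i (if P i then row i M else 0).
have M'nu : M'^t* \notin unitmx.
  rewrite map_unitmx unitmx_tr; apply/negP => M'u.
  have /matrixP/(_ i0 i0)/eqP := mulmxV M'u.
  rewrite !mxE eqxx big1 ?(eq_sym 0) ?oner_eq0 // => j _.
  by rewrite mxE (negbTE Pi0) mxE mul0r.
have [v vM' v0] : exists2 v : 'rV[C]_n, v *m M'^t* = 0 & v != 0.
  move: M'nu; rewrite -row_free_unit -kermx_eq0 => /rowV0Pn[v /sub_kermxP vM' v0].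
  by exists v.
have v_row j : P j -> (v *m (row j M)^t*) 0 0 = 0.
  move=> Pj; have /rowP/(_ j) := vM'; rewrite !mxE => vj; rewrite -[RHS]vj.
  by apply: eq_bigr => l _; rewrite !mxE Pj !mxE.
pose s := sqrtC ((v *m v^t*) 0 0).
have s_gt0 : 0 < s by rewrite sqrtC_gt0 lt_def sqnorm_eq0 v0 sqnorm_ge0.
have s2 : s * s = (v *m v^t*) 0 0 by rewrite -expr2 sqrtCK.
have s_conj : s^* = s by apply/CrealP; rewrite gtr0_real.
pose w := s^-1 *: v.
have w_norm : (w *m w^t*) 0 0 = 1.
  rewrite /w linearZ map_mxZ /= -scalemxAl -scalemxAr scalerA mxE -s2 fmorphV /= s_conj.
  by field; rewrite gt_eqF.
have w_row j : P j -> (w *m (row j M)^t*) 0 0 = 0.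
  by move=> Pj; rewrite -scalemxAl mxE v_row // mulr0.
clearbody w.
have row_w j : P j -> (row j M *m w^t*) 0 0 = 0.
  move=> Pj; have := w_row j Pj => /(congr1 (@Num.conj C)); rewrite rmorph0 => <-.
  by rewrite !mxE rmorph_sum; apply: eq_bigr => l _; rewrite !mxE rmorphM /= conjCK mulrC.
pose N : 'M[C]_n := \matrix_i (if i == i0 then w else row i M).
have rowN i : row i N = if i == i0 then w else row i M by rewrite rowK.
pose Q := [pred i | P i || (i == i0)].
have ltQm : (#|predC Q| < m)%N.
  rewrite ltnS in ltPm; apply: leq_trans ltPm; apply: proper_card; apply/properP; split.
    by apply/subsetP => i; rewrite !inE negb_or => /andP[].
  by exists i0; rewrite !inE ?Pi0 // eqxx orbT.
have [|S Su SN] := IH Q ltQm N.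
  move=> i j; rewrite !rowN /=.
  have [->|ii0] := eqVneq i i0; have [->|ji0] := eqVneq j i0; rewrite ?orbT ?orbF ?eqxx //.
  - by move=> _ Pj; rewrite w_row // eq_sym (negbTE ji0).
  - by move=> Pi _; rewrite row_w // (negbTE ii0).
  - exact: orthM.
exists S => // i Pi; rewrite SN /= ?Pi // rowN.
by case: eqP Pi => // ->; rewrite (negbTE Pi0).
Qed.

(** Indexed by natural numbers to fit [sv] and the sums over [i < k]. *)
Definition diag_of_nat (d : nat -> C) : 'M[C]_n := diag_mx (\row_i d i).

Lemma diag_of_nat_entry m p (A : 'M[C]_(m, n)) (d : nat -> C) (B : 'M[C]_(n, p)) i j :
  (A *m diag_of_nat d *m B) i j = \sum_(l < n) d l * (A i l * B l j).
Proof. by rewrite mul_diag_entry; apply: eq_bigr => l _; rewrite mxE. Qed.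

Lemma sv_perm A : exists p : 'S_n, forall i : 'I_n,
  sv A i = sqrtC (spectral_diag (adjmx A *m A) 0 (p i)).
Proof.
set mu := fun i => sqrtC (spectral_diag (adjmx A *m A) 0 i).
have : perm_eq (sv_seq A) [tuple mu i | i < n] by rewrite perm_sort.
move=> /tuple_permP[p svE]; exists p => i.
rewrite /sv svE (nth_map i) ?size_enum_ord // nth_ord_enum.
by rewrite tnth_map tnth_ord_tuple.
Qed.

Lemma sv_ge0 A i : 0 <= sv A i.
Proof.
have [ltin|lein] := ltnP i n; last first.
  by rewrite /sv nth_default // size_sort size_map size_enum_ord.
have [V [_ d0 _]] := psd_spectral (gram_psd A); have [p pE] := sv_perm A.
by rewrite (pE (Ordinal ltin)) sqrtC_ge0.
Qed.

Lemma sv_noninc A i j : (i <= j < n)%N -> sv A j <= sv A i.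
Proof.
move=> /andP[leij ltjn].
have ltin : (i < n)%N := leq_ltn_trans leij ltjn.
have sz : size (sv_seq A) = n by rewrite size_sort size_map size_enum_ord.
apply: (@sorted_leq_nth _ (fun x y : C => y <= x)) => //; rewrite ?inE ?sz //.
- by move=> y x z yx zy; apply: le_trans zy yx.
(* The order of [C] is total only on real elements, so the sort is analysed on that subset. *)
apply: (@sort_sorted_in _ (mem Num.real)).
  by move=> x y xr yr; rewrite orbC; apply: real_leVge.
rewrite all_map; apply/allP => l _ /=.
have [V [_ d0 _]] := psd_spectral (gram_psd A).
by apply: ger0_real; rewrite sqrtC_ge0.
Qed.

(** Permuting the rows of the eigenbasis puts the eigenvalues into the order of [sv]. *)
Lemma gram_diag A : exists2 V, V \is unitarymx &
  adjmx A *m A = V^t* *m diag_of_nat (fun i => sv A i ^+ 2) *m V.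
Proof.
have [V [Vu d0 VE]] := psd_spectral (gram_psd A); have [p pE] := sv_perm A.
exists (row_perm p V).
  apply/row_unitarymxP => i j.
  rewrite -(inj_eq (@perm_inj _ p)) -(row_unitarymxP Vu).
  by congr (dotmx _ _); apply/rowP => l; rewrite !mxE.
rewrite {1}VE; apply/matrixP => i j; rewrite mul_diag_entry diag_of_nat_entry.
rewrite (reindex_inj (@perm_inj _ p)) /=; apply: eq_bigr => l _.
by rewrite pE sqrtCK !mxE.
Qed.

Lemma diag_of_nat_adj (d : nat -> C) : (forall i, 0 <= d i) -> (diag_of_nat d)^t* = diag_of_nat d.
Proof.
move=> d0; apply/matrixP => i j; rewrite !mxE eq_sym rmorphMn /=.
by case: eqP => [->|//]; rewrite !mulr1n; apply/CrealP/ger0_real.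
Qed.

(* The rows of V A^* are orthogonal with norms s_i; normalising the nonzero
   ones and completing gives the left singular vectors. *)
Lemma svd A : exists S V, [/\ S \is unitarymx, V \is unitarymx,
  A = S^t* *m diag_of_nat (sv A) *m V &
  adjmx A *m A = V^t* *m diag_of_nat (fun i => sv A i ^+ 2) *m V].
Proof.
have [V Vu VE] := gram_diag A.
pose M := V *m A^t*.
have MM : M *m M^t* = diag_of_nat (fun i => sv A i ^+ 2).
  rewrite trmxC_mul trmxCK mulmxA -[V *m _ *m _]mulmxA VE.
  by rewrite !mulmxA (unitarymxP Vu) mul1mx mulmxtVK.
have M_row (i j : 'I_n) : (row i M *m (row j M)^t*) 0 0 = sv A i ^+ 2 *+ (i == j).
  have := mulmx_row_entry M 1%:M M i j; rewrite !mulmx1 => <-.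
  by rewrite MM !mxE.
pose N := \matrix_(i < n) ((sv A i)^-1 *: row i M).
have [|S Su SN] := @orthonormal_completion (fun i : 'I_n => sv A i != 0) N.
  move=> i j si sj; rewrite !rowK linearZ map_mxZ /= -scalemxAl -scalemxAr scalerA mxE.
  rewrite M_row fmorphV /= (CrealP (ger0_real (sv_ge0 A j))).
  by case: eqP => [->|_]; rewrite ?mulr0 // !mulr1n; field.
have MS : M = diag_of_nat (sv A) *m S.
  suff rowM (i : 'I_n) : row i M = sv A i *: row i S.
    apply/matrixP => i j; have /rowP/(_ j) := rowM i; rewrite [LHS]mxE => ->.
    by rewrite mul_diag_mx !mxE.
  have [si0|si0] := eqVneq (sv A i) 0; last first.
    by rewrite SN // rowK scalerA divff // scale1r.
  rewrite si0 scale0r; apply/eqP; rewrite -sqnorm_eq0 M_row si0.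
  by rewrite expr0n mul0rn.
exists S, V; split=> //.
have AV : A *m V^t* = M^t* by rewrite trmxC_mul trmxCK.
by rewrite -[LHS](mulmxKtV _ Vu) // AV MS trmxC_mul diag_of_nat_adj // => i; apply: sv_ge0.
Qed.

(** Uniqueness of the positive square root: the change of basis [Z] between the two eigenbases
    intertwines the squares, so a nonzero entry [Z i j] forces the squares of [r i] and [d j] to
    agree, hence also the nonnegative numbers themselves. *)
Lemma psd_sqrt_diag P V (d : nat -> C) : V \is unitarymx -> psdmx P ->
  (forall i, 0 <= d i) -> P *m P = V^t* *m diag_of_nat (fun i => d i ^+ 2) *m V ->
  P = V^t* *m diag_of_nat d *m V.
Proof.
move=> Vu /psd_spectral[R [Ru r0 PE]] d0 PP.
set r := spectral_diag P in r0 PE.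
pose Z := R *m V^t*.
have Zrd : diag_mx r *m diag_mx r *m Z = Z *m diag_of_nat (fun i => d i ^+ 2).
  have RV := congr1 (fun X => R *m X *m V^t*) PP.
  rewrite {1 2}PE !mulmxA (unitarymxP Ru) mul1mx mulmxtVK // in RV.
  by rewrite mulmxtVK // in RV; rewrite /Z mulmxA.
have ZV : Z *m V = R by rewrite /Z mulmxKtV.
have RZ : R^t* *m Z = V^t* by rewrite /Z mulmxA (unitarymxV Ru) mul1mx.
clearbody Z.
have Zd : diag_mx r *m Z = Z *m diag_of_nat d.
  apply/matrixP => i j; have /matrixP/(_ i j) := Zrd.
  rewrite -mulmxA !mul_diag_mx !mul_mx_diag !mxE.
  have [-> _|z0] := eqVneq (Z i j) 0; first by rewrite mulr0 mul0r.
  rewrite mulrA mulrC => /(mulfI z0)/eqP; rewrite -expr2 eqrXn2 ?d0 // => /eqP->.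
  by rewrite mulrC.
transitivity (R^t* *m (diag_mx r *m Z) *m V).
  by rewrite -!mulmxA ZV mulmxA -PE.
by rewrite Zd mulmxA RZ.
Qed.

End SingularValues.

(** * The Ky Fan norm through duality *)

Section KyFan.
Variables (C : numClosedFieldType) (n k : nat).
Hypothesis kn : (1 <= k <= n)%N.
Implicit Types (A X V S R M G H : 'M[C]_n).

Lemma unitarymx1 m : (1%:M : 'M[C]_m) \is unitarymx.
Proof. by apply/unitarymxP; rewrite mul1mx trmx1 map_mx1. Qed.

Lemma trace_dual_ball_le M S V (d : nat -> C) : dual_ball k M ->
  S \is unitarymx -> V \is unitarymx ->
  (forall i j, (i <= j < n)%N -> d j <= d i) -> (forall i, 0 <= d i) ->
  `|\tr (M *m (S^t* *m diag_of_nat n d *m V))| <= \sum_(i < k) d i.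
Proof.
move=> [M1 M2] Su Vu dd d0.
(* The moduli of the diagonal of [V M S^*], extended by 0 to all natural indices as
   [weighted_sum_le] requires. *)
pose b j := if insub j is Some i then `|(V *m M *m S^t*) i i| else 0.
have bE (i : 'I_n) : b i = `|(V *m M *m S^t*) i i| by rewrite /b valK.
have b_le1 (i : 'I_n) : b i <= 1.
  by rewrite bE mulmx_row_entry M1 ?sqnorm_row_unitary.
apply: (@le_trans _ _ (\sum_(i < n) d i * b i)).
  rewrite !mulmxA mxtrace_mulC !mulmxA.
  apply: le_trans (ler_norm_sum _ _ _) _; apply: ler_sum => i _.
  by rewrite mul_mx_diag !mxE normrM mulrC (ger0_norm (d0 i)) bE mxE.
apply: weighted_sum_le => // [i ltin|].
  have -> : i = Ordinal ltin by [].
  by rewrite b_le1 bE normr_ge0.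
under eq_bigr do rewrite bE.
by apply: M2; rewrite ?trmxC_unitary.
Qed.

Lemma kyfan_ge M X : dual_ball k M -> `|\tr (M *m X)| <= kyfan k X.
Proof.
move=> Mb; have [S [V [Su Vu XE _]]] := svd X.
rewrite {1}XE; apply: trace_dual_ball_le => // [i j|i]; first exact: sv_noninc.
exact: sv_ge0.
Qed.

(** The optimal [M] sends the first [k] singular vectors of one side to those of the other. With
    [kyfan_ge] this presents the norm as a maximum, from which the norm properties follow. *)
Lemma kyfan_attained X : exists2 M, dual_ball k M & \tr (M *m X) = kyfan k X.
Proof.
have [S [V [Su Vu XE _]]] := svd X.
pose p : 'rV[C]_n := \row_i (i < k)%:R.
exists (V^t* *m diag_mx p *m S).
  apply: dual_ball_mul; rewrite ?trmxC_unitary //.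
  apply: dual_ball_diag => [j|]; first by rewrite mxE ler0n lern1 leq_b1.
  under eq_bigr do rewrite mxE.
  have /andP[_ le_kn] := kn.
  rewrite -natr_sum ler_nat -(big_mkcond (fun i : 'I_n => i < k)%N) /=.
  rewrite -(big_ord_widen _ (fun=> 1%N)) //.
  by rewrite sum1_card card_ord.
rewrite {1}XE !mulmxA (mulmxtVK _ Su) mxtrace_mulC !mulmxA (unitarymxP Vu) mul1mx.
have /andP[_ le_kn] := kn.
rewrite /kyfan (big_ord_widen _ _ le_kn) [RHS]big_mkcond; apply: eq_bigr => i _.
rewrite mul_diag_mx !mxE eqxx mulr1n.
by case: ifP => _; rewrite ?mul1r ?mul0r.
Qed.

Lemma kyfan_ge0 X : 0 <= kyfan k X.
Proof. by apply: sumr_ge0 => i _; apply: sv_ge0. Qed.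

(** By duality, a decomposition with ordered nonnegative [d] bounds the norm without identifying [d]
    with the singular values. *)
Lemma kyfan_le_svd S V (d : nat -> C) : S \is unitarymx -> V \is unitarymx ->
  (forall i j, (i <= j < n)%N -> d j <= d i) -> (forall i, 0 <= d i) ->
  kyfan k (S^t* *m diag_of_nat n d *m V) <= \sum_(i < k) d i.
Proof.
move=> Su Vu dd d0; have [M Mb ME] := kyfan_attained (S^t* *m diag_of_nat n d *m V).
by rewrite -(ger0_norm (kyfan_ge0 _)) -ME trace_dual_ball_le.
Qed.

Lemma kyfanD X Y : kyfan k (X + Y) <= kyfan k X + kyfan k Y.
Proof.
have [M Mb ME] := kyfan_attained (X + Y).
rewrite -(ger0_norm (kyfan_ge0 _)) -ME mulmxDr raddfD /=.
by apply: le_trans (ler_normD _ _) _; rewrite lerD // kyfan_ge.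
Qed.

Lemma kyfan_mul_le G X : G \is unitarymx -> kyfan k (G *m X) <= kyfan k X.
Proof.
move=> Gu; have [M Mb ME] := kyfan_attained (G *m X).
rewrite -(ger0_norm (kyfan_ge0 _)) -ME mulmxA kyfan_ge //.
have := dual_ball_mul (_ : 1%:M \is unitarymx) Gu Mb; rewrite mul1mx; apply.
exact: unitarymx1.
Qed.

Lemma kyfan_unitary_mul G X : G \is unitarymx -> kyfan k (G *m X) = kyfan k X.
Proof.
move=> Gu; apply/eqP; rewrite eq_le kyfan_mul_le //=.
by rewrite -[X in kyfan k X <= _]mul1mx -(unitarymxV Gu) -mulmxA kyfan_mul_le // trmxC_unitary.
Qed.

Lemma kyfan_mulr_le X G : G \is unitarymx -> kyfan k (X *m G) <= kyfan k X.
Proof.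
move=> Gu; have [M Mb ME] := kyfan_attained (X *m G).
rewrite -(ger0_norm (kyfan_ge0 _)) -ME mulmxA mxtrace_mulC mulmxA kyfan_ge //.
have := dual_ball_mul Gu (_ : 1%:M \is unitarymx) Mb; rewrite mulmx1; apply.
exact: unitarymx1.
Qed.

Lemma kyfanZ_le (c : C) X : 0 <= c -> kyfan k (c *: X) <= c * kyfan k X.
Proof.
move=> c0; have [M Mb ME] := kyfan_attained (c *: X).
rewrite -(ger0_norm (kyfan_ge0 (c *: X))) -ME -scalemxAr linearZ /= normrM ger0_norm //.
by rewrite ler_wpM2l // kyfan_ge.
Qed.

Lemma kyfanZ (c : C) X : 0 < c -> kyfan k (c *: X) = c * kyfan k X.
Proof.
move=> c0; apply/eqP; rewrite eq_le (kyfanZ_le _ (ltW c0)) /=.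
have ci : 0 <= c^-1 by rewrite invr_ge0 ltW.
have := kyfanZ_le (c *: X) ci.
by rewrite scalerA mulVf ?gt_eqF // scale1r ler_pdivlMl.
Qed.

Lemma kyfan0 : kyfan k (0 : 'M[C]_n) = 0.
Proof.
by apply/eqP; rewrite eq_le kyfan_ge0 andbT -(scale0r 0)
  -[leRHS](mul0r (kyfan k (0 : 'M[C]_n))) kyfanZ_le.
Qed.

Lemma kyfan_unitary G : G \is unitarymx -> kyfan k G <= k%:R.
Proof.
move=> Gu; have [M [_ M2] ME] := kyfan_attained G.
rewrite -(ger0_norm (kyfan_ge0 _)) -ME; apply: le_trans (ler_norm_sum _ _ _) _.
by have := M2 1%:M G (unitarymx1 n) Gu; rewrite mul1mx.
Qed.

Lemma kyfan_rank_one (x y : 'rV[C]_n) : (x *m x^t*) 0 0 = 1 -> (y *m y^t*) 0 0 = 1 ->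
  kyfan k (y^t* *m x) <= 1.
Proof.
move=> x1 y1; have [M [M1 _] ME] := kyfan_attained (y^t* *m x).
rewrite -(ger0_norm (kyfan_ge0 _)) -ME mulmxA mxtrace_mulC mulmxA.
by rewrite trace_mx11 M1.
Qed.

End KyFan.

(** * The one-step Hahn-Banach extension over the reals of [C] *)

Section HahnBanach.
Variables (C : numClosedFieldType) (n k : nat).
Hypothesis kn : (1 <= k <= n)%N.
Local Notation F := (realsub C).
Local Notation f := (@realval C).

Section CutDefinable.
Variables (J : finType) (v : J -> 'M[C]_n) (w : 'M[C]_n) (a : J -> C).
Hypothesis a_real : forall i, a i \is Num.real.

(* Unknowns: the coefficients, the real and imaginary parts of two unitary
   matrices, square roots of the gaps between singular values, and a slack. *)
Let I : finType := (J + bool * bool * 'I_n * 'I_n + 'I_n + unit)%type.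

Let coef (x : I -> F) i : C := f (x (inl (inl (inl i)))).
Let mat (s : bool) (x : I -> F) : 'M[C]_n :=
  \matrix_(i, j) (f (x (inl (inl (inr (s, true, i, j))))) +
                  'i * f (x (inl (inl (inr (s, false, i, j)))))).
Let sing (x : I -> F) (j : nat) : C := \sum_(l < n | (j <= l)%N) f (x (inl (inr l))) ^+ 2.
Let slack (x : I -> F) : C := f (x (inr tt)) ^+ 2.

(** A polynomial form of the inequality in [cut_systemP]. Each [sing x j] is a tail sum of squares,
    which makes the diagonal nonnegative and nonincreasing, and the square [slack] turns the
    inequality into an equation. *)
Let cut_system (c : F) (x : I -> F) : Prop :=
  (mat true x *m (mat true x)^t* = 1%:M /\ mat false x *m (mat false x)^t* = 1%:M) /\
  (\sum_i coef x i *: v i - w = (mat true x)^t* *m diag_of_nat n (sing x) *m mat false x /\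
   f c = \sum_i coef x i * a i - \sum_(j < k) sing x j - slack x).

Lemma polyfun_cst (z : C) : polyfun f (fun _ (_ : I -> F) => z).
Proof.
have [x xE] := realval_onto (Creal_Re z); have [y yE] := realval_onto (Creal_Im z).
by apply: (@polyfun_const _ _ _ _ z x y); rewrite /= xE yE -Crect.
Qed.

Lemma definable_cut_system : definable cut_system.
Proof.
have pvar i : polyfun f (fun _ (x : I -> F) => f (x i)) by apply: polyfun_var.
have psq i : polyfun f (fun _ (x : I -> F) => f (x i) ^+ 2).
  by apply: polyfun_ext (polyfunM (pvar i) (pvar i)) => c x; rewrite expr2.
have pmat s i j : polyfun f (fun _ x => mat s x i j).
  apply: polyfun_ext (polyfunD (pvar _) (polyfunM (polyfun_cst 'i) (pvar _))) => c x.
  by rewrite mxE.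
have padj s i j : polyfun f (fun _ x => (mat s x)^t* i j).
  by apply: polyfun_ext (polyfun_conj (@realval_real C) (pmat s j i)) => c x; rewrite !mxE.
have psing j : polyfun f (fun _ x => sing x j) by apply: polyfun_sum => l; apply: psq.
have pdg i j : polyfun f (fun _ x => diag_of_nat n (sing x) i j).
  apply: polyfun_ext (polyfunM (psing i) (polyfun_cst (i == j)%:R)) => c x.
  by rewrite !mxE mulr_natr.
apply: definable_and; first apply: definable_and.
- apply: (@definable_eqmx _ _ f (@realval_real C) _ _ _ _ (fun _ _ => 1%:M)) => i j;
    last exact: polyfun_cst.
  by apply: (polyfun_mulmx (A := fun _ x => mat true x)).
- apply: (@definable_eqmx _ _ f (@realval_real C) _ _ _ _ (fun _ _ => 1%:M)) => i j;
    last exact: polyfun_cst.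
  by apply: (polyfun_mulmx (A := fun _ x => mat false x)).
apply: definable_and.
  apply: (@definable_eqmx _ _ f (@realval_real C)) => i j.
    have pcomb := polyfun_sum _ _
      (fun l => polyfunM (pvar (inl (inl (inl l)))) (polyfun_cst (v l i j))).
    apply: polyfun_ext (polyfunD (pcomb _ _) (polyfun_cst (- w i j))) => c x.
    by rewrite !mxE summxE; congr (_ + _); apply: eq_bigr => l _; rewrite mxE.
  apply: (polyfun_mulmx (A := fun _ x => (mat true x)^t* *m diag_of_nat n (sing x))) => {}i {}j //.
  exact: (polyfun_mulmx (A := fun _ x => (mat true x)^t*)).
apply: (@definable_eq _ _ f (@realval_real C)); first exact: polyfun_param.
apply: polyfunD; last by apply: polyfunN; apply: psq.
apply: polyfunD; last by apply: polyfunN; apply: polyfun_sum => l; apply: psing.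
by apply: polyfun_sum => l; apply: polyfunM (polyfun_cst _); apply: pvar.
Qed.

(** A solution bounds the norm by [kyfan_le_svd]; conversely a singular value decomposition, with
    square roots of its gaps and of the slack, is a solution. *)
Lemma cut_systemP c : (exists x, cut_system c x) <->
  exists y : J -> C, (forall i, y i \is Num.real) /\
    f c <= \sum_i y i * a i - kyfan k (\sum_i y i *: v i - w).
Proof.
split=> [[x [[/unitarymxP Su /unitarymxP Ru] [XE cE]]]|[y [yr cy]]].
  exists (coef x); split=> [i|]; first exact: realval_real.
  have sq0 i : 0 <= f (x i) ^+ 2 by rewrite -realEsqr realval_real.
  have sing_ge0 i : 0 <= sing x i by apply: sumr_ge0 => l _; apply: sq0.
  have sing_noninc i j : (i <= j < n)%N -> sing x j <= sing x i.
    move=> /andP[leij _]; rewrite /sing big_mkcond [leRHS]big_mkcond.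
    apply: ler_sum => l _; case: leqP => [lejl|_]; first by rewrite (leq_trans leij).
    by case: ifP => _; rewrite ?sq0.
  rewrite cE XE -[leRHS]subr0; apply: lerB; last exact: sq0.
  by apply: lerB => //; apply: kyfan_le_svd.
set X := (X in kyfan k X) in cy; have [S [V [Su Vu XE _]]] := svd X.
(* For [l = n - 1] the next singular value is the default 0, so that the gaps telescope to
   [sv X j]. *)
have gap_real l : sqrtC (sv X l - sv X l.+1) \is Num.real.
  rewrite ger0_real // sqrtC_ge0 subr_ge0; have [ltn|len] := ltnP l.+1 n.
    by apply: sv_noninc; rewrite leqnSn.
  by rewrite [sv X l.+1]nth_default ?sv_ge0 // size_sort size_map size_enum_ord.
have slack_real : sqrtC (\sum_i y i * a i - kyfan k X - f c) \is Num.real.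
  by rewrite ger0_real // sqrtC_ge0 subr_ge0.
pose x (i : I) : F := match i with
  | inl (inl (inl i)) => RealSub (yr i)
  | inl (inl (inr (s, b, i, j))) => let M := if s then S else V in
      if b then RealSub (Creal_Re (M i j)) else RealSub (Creal_Im (M i j))
  | inl (inr l) => RealSub (gap_real l)
  | inr _ => RealSub slack_real end.
have matS : mat true x = S by apply/matrixP => i j; rewrite mxE /= -Crect.
have matV : mat false x = V by apply/matrixP => i j; rewrite mxE /= -Crect.
have singE j : sing x j = sv X j.
  rewrite /sing /=; under eq_bigr do rewrite sqrtCK.
  have sv_out i : (n <= i)%N -> sv X i = 0.
    by move=> lein; rewrite [LHS]nth_default // size_sort size_map size_enum_ord.
  have [ltjn|lenj] := ltnP j n; last first.
    rewrite sv_out // big1 // => l; have := ltn_ord l.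
    by move=> ltln /(leq_trans lenj); rewrite leqNgt ltln.
  rewrite -(big_geq_mkord _ _ xpredT (fun l => sv X l - sv X l.+1)).
  transitivity (sv X j - sv X n); last by rewrite (sv_out n) ?subr0.
  rewrite -opprB -(telescope_sumr _ (ltnW ltjn)).
  by rewrite -sumrN; apply: eq_bigr => l _; rewrite opprB.
exists x; rewrite /cut_system matS matV; split.
  by split; apply/unitarymxP.
split.
  rewrite -/X {1}XE; congr (_ *m _ *m _); congr diag_mx.
  by apply/rowP => i; rewrite !mxE singE.
rewrite /slack /= sqrtCK; under [X in _ - X - _]eq_bigr do rewrite singE.
by rewrite -/(kyfan k X) opprB addrC subrK.
Qed.

Hypothesis dominated : forall y : J -> C, (forall i, y i \is Num.real) ->
  \sum_i y i * a i <= kyfan k (\sum_i y i *: v i).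

Lemma combination_real (y : J -> C) : (forall i, y i \is Num.real) ->
  \sum_i y i * a i \is Num.real.
Proof. by move=> yr; apply: rpred_sum => i _; rewrite rpredM. Qed.

Lemma kyfan_real X : @kyfan C n k X \is Num.real.
Proof. exact/ger0_real/kyfan_ge0. Qed.

(** The triangle inequality after [w] cancels: every lower bound on the value at [w] lies below
    every upper bound. *)
Lemma cut_le (x y : J -> C) : (forall i, x i \is Num.real) ->
  (forall i, y i \is Num.real) ->
  \sum_i x i * a i - kyfan k (\sum_i x i *: v i - w) <=
  kyfan k (\sum_i y i *: v i + w) - \sum_i y i * a i.
Proof.
move=> xr yr; rewrite lerBrDr addrAC lerBlDr.
have := dominated (fun i => rpredD (xr i) (yr i)).
have -> : \sum_i (x i + y i) * a i = \sum_i x i * a i + \sum_i y i * a i.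
  by rewrite -big_split; apply: eq_bigr => i _; rewrite mulrDl.
move=> /le_trans; apply.
have -> : \sum_i (x i + y i) *: v i = \sum_i y i *: v i + w + (\sum_i x i *: v i - w).
  rewrite addrACA subrr addr0 -big_split; apply: eq_bigr => i _.
  by rewrite scalerDl addrC.
exact: kyfanD.
Qed.

(** The value [b] at [w] is the supremum of the lower bounds. For [t > 0] the claim is an upper
    bound on [b] scaled by [t], for [t < 0] a lower bound scaled by [- t], and for [t = 0] the
    assumed domination. *)
Lemma hahn_banach_step : exists2 b, b \is Num.real &
  forall t (y : J -> C), t \is Num.real -> (forall i, y i \is Num.real) ->
    \sum_i y i * a i + t * b <= kyfan k (\sum_i y i *: v i + t *: w).
Proof.
pose val (y : J -> C) := \sum_i y i * a i - kyfan k (\sum_i y i *: v i - w).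
have val_attained (y : J -> C) : (forall i, y i \is Num.real) ->
    exists c x, f c = val y /\ cut_system c x.
  move=> yr; have [c cE] := realval_onto (rpredB (combination_real yr)
    (kyfan_real (\sum_i y i *: v i - w))).
  exists c; have /cut_systemP[x xP] : exists y : J -> C, (forall i, y i \is Num.real) /\
      f c <= \sum_i y i * a i - kyfan k (\sum_i y i *: v i - w).
    by exists y; rewrite cE.
  by exists x.
have r0 (i : J) : (0 : C) \is Num.real by [].
have cut_bound (y : J -> C) : (forall i, y i \is Num.real) -> forall c x,
    cut_system c x -> f c <= kyfan k (\sum_i y i *: v i + w) - \sum_i y i * a i.
  move=> yr c x xP; have /cut_systemP[z [zr cz]] : exists x, cut_system c x by exists x.
  by apply: le_trans cz _; apply: cut_le.
have upper_real (y : J -> C) : (forall i, y i \is Num.real) ->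
    exists b : F, f b = kyfan k (\sum_i y i *: v i + w) - \sum_i y i * a i.
  by move=> yr; apply/realval_onto/rpredB; [exact: kyfan_real|exact: combination_real].
have [|||b [b_ub b_lub]] := definable_sup definable_cut_system.
- move=> p q pq /cut_systemP[y [yr qy]]; apply/cut_systemP; exists y; split=> //.
  exact: le_trans qy.
- by have [c [x [_ xP]]] := val_attained _ r0; exists c, x.
- have [u uE] := upper_real _ r0; exists u => c x xP.
  by rewrite le_realval uE; apply: (cut_bound _ r0 _ x).
exists (f b) => [|t y tr yr]; first exact: realval_real.
have lower (z : J -> C) : (forall i, z i \is Num.real) -> val z <= f b.
  by move=> zr; have [c [x [<- xP]]] := val_attained _ zr; rewrite -le_realval (b_ub _ x).
have upper (z : J -> C) : (forall i, z i \is Num.real) ->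
    f b <= kyfan k (\sum_i z i *: v i + w) - \sum_i z i * a i.
  move=> zr; have [u uE] := upper_real _ zr; rewrite -uE -le_realval.
  by apply: b_lub => c x xP; rewrite le_realval uE; apply: (cut_bound _ zr _ x).
have scale s : s != 0 -> (\sum_i (y i / s) * a i = s^-1 * \sum_i y i * a i) /\
    (\sum_i (y i / s) *: v i = s^-1 *: \sum_i y i *: v i).
  move=> s0; rewrite mulr_sumr scaler_sumr; split; apply: eq_bigr => i _.
    by rewrite mulrAC mulrC.
  by rewrite scalerA mulrC.
have [t_gt0|t_lt0|->] := real_ltgt0P tr; last first.
- by rewrite mul0r scale0r !addr0 dominated.
- have s_gt0 : 0 < - t by rewrite oppr_gt0.
  have s0 : - t != 0 by rewrite gt_eqF.
  have [sE1 sE2] := scale _ s0.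
  have yr' i : y i / - t \is Num.real by rewrite rpred_div ?rpredN.
  have := lower _ yr'; rewrite /val sE1 sE2 => /(ler_wpM2l (ltW s_gt0)).
  rewrite mulrBr mulVKf // -kyfanZ // scalerBr scalerA divff // scale1r scaleNr opprK.
  by rewrite lerBlDr mulNr addrC lerBrDr.
have t0 : t != 0 by rewrite gt_eqF.
have [sE1 sE2] := scale _ t0.
have yr' i : y i / t \is Num.real by rewrite rpred_div.
have := upper _ yr'; rewrite sE1 sE2 => /(ler_wpM2l (ltW t_gt0)).
rewrite mulrBr mulVKf // -kyfanZ // scalerDr scalerA divff // scale1r.
by rewrite lerBrDr addrC.
Qed.

End CutDefinable.
End HahnBanach.

(** * Dominated real functionals and their extension to all matrices *)

Section SupportFunctional.
Variables (C : numClosedFieldType) (n k : nat).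
Hypothesis kn : (1 <= k <= n)%N.

(** A real functional on the real span of [v], given by its values [a]. Domination makes it well
    defined: a real relation among the [v j], taken with both signs, also holds among the [a j]. *)
Definition kyfan_dominated (J : finType) (v : J -> 'M[C]_n) (a : J -> C) :=
  (forall j, a j \is Num.real) /\
  forall y : J -> C, (forall j, y j \is Num.real) ->
    \sum_j y j * a j <= kyfan k (\sum_j y j *: v j).

(** The vectors [w i] are adjoined one at a time, each enlarging the index type by a copy of
    ['I_1]. *)
Lemma hahn_banach p (w : 'I_p -> 'M[C]_n) (J : finType) v a : @kyfan_dominated J v a ->
  exists b : 'I_p -> C, kyfan_dominated
    (fun s : J + 'I_p => match s with inl j => v j | inr i => w i end)
    (fun s => match s with inl j => a j | inr i => b i end).
Proof.
elim: p w J v a => [|p IH] w J v a [ar dom].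
  exists (fun=> 0); split=> [[]//|y yr]; rewrite !big_sumType !big_ord0 /= !addr0.
  exact: dom.
have [b0 b0r step] := hahn_banach_step kn (w ord0) ar dom.
have [|b [br bdom]] := IH (fun i => w (lift ord0 i)) (J + 'I_1)%type
    (fun s => if s is inl j then v j else w ord0) (fun s => if s is inl j then a j else b0).
  split=> [[]//|y yr]; rewrite !big_sumType !big_ord1.
  exact: (step (y (inr ord0)) (fun j => y (inl j))).
exists (fun i => if unlift ord0 i is Some j then b j else b0); split=> [[//|i]|y yr].
  by case: unliftP => // j _; apply: (br (inr j)).
have := bdom (fun s => match s with inl (inl j) => y (inl j)
  | inl (inr _) => y (inr ord0) | inr i => y (inr (lift ord0 i)) end).
rewrite !big_sumType !big_ord1 !big_ord_recl unlift_none /= !addrA.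
under [X in _ -> _ + X <= _]eq_bigr do rewrite liftK.
by apply=> -[[|]|].
Qed.

Lemma Re_trace_adj (T X : 'M[C]_n) : 'Re (\tr (T^t* *m X)) =
  \sum_i \sum_j ('Re (X i j) * 'Re (T i j) + 'Im (X i j) * 'Im (T i j)).
Proof.
rewrite /mxtrace raddf_sum exchange_big /=; apply: eq_bigr => i _.
rewrite mxE raddf_sum /=; apply: eq_bigr => j _; rewrite !mxE /= ReM Re_conj Im_conj.
by rewrite mulNr opprK mulrC [X in _ + X]mulrC.
Qed.

(** Extend to a real basis of the matrix space and read the functional off as a trace pairing. *)
Lemma norming_functional (J : finType) (v : J -> 'M[C]_n) (a : J -> C) :
  kyfan_dominated v a -> exists T : 'M[C]_n,
    (forall X, 'Re (\tr (T^t* *m X)) <= kyfan k X) /\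
    (forall j, 'Re (\tr (T^t* *m v j)) = a j).
Proof.
(* [K] indexes the matrix units and their multiples by ['i]; the values there are the real and
   imaginary parts of the entries of [T]. *)
pose K : finType := ('I_n * 'I_n * bool)%type.
pose e (t : K) : 'M[C]_n := (if t.2 then 1 else 'i) *: delta_mx t.1.1 t.1.2.
move=> /(hahn_banach (fun i : 'I_#|K| => e (enum_val i)))[b [abr dom]].
pose c t := b (enum_rank t).
have br i : b i \is Num.real by apply: (abr (inr i)).
pose T := \matrix_(i, j) (c (i, j, true) + 'i * c (i, j, false)).
have sumK (R : nmodType) (F : K -> R) : \sum_t F t =
    \sum_i \sum_j (F (i, j, true) + F (i, j, false)).
  transitivity (\sum_u \sum_s F (u, s)).
    by rewrite pair_bigA; apply: eq_bigr => -[].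
  by rewrite [RHS]pair_bigA; apply: eq_bigr => -[i j] _; rewrite big_bool.
have sum_enum (R : nmodType) (F : K -> R) : \sum_t F t = \sum_(i < #|K|) F (enum_val i).
  by rewrite (reindex _ (onW_bij _ (@enum_val_bij K))).
pose x_ (X : 'M[C]_n) (t : K) := if t.2 then 'Re (X t.1.1 t.1.2) else 'Im (X t.1.1 t.1.2).
have x_real X t : x_ X t \is Num.real by rewrite /x_; case: ifP.
have decomp X : \sum_t x_ X t *: e t = X.
  rewrite sumK [RHS]matrix_sum_delta; apply: eq_bigr => i _; apply: eq_bigr => j _.
  by rewrite /x_ /e /= !scalerA -scalerDl mulr1 [_ * 'i]mulrC -Crect.
have pairing X : \sum_t x_ X t * c t = 'Re (\tr (T^t* *m X)).
  rewrite sumK Re_trace_adj; apply: eq_bigr => i _; apply: eq_bigr => j _.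
  by rewrite /x_ /= mxE Re_rect ?Im_rect ?br.
have dom' (y : J -> C) X : (forall j, y j \is Num.real) ->
    \sum_j y j * a j + 'Re (\tr (T^t* *m X)) <= kyfan k (\sum_j y j *: v j + X).
  have p1 : \sum_(i < #|K|) x_ X (enum_val i) * b i = 'Re (\tr (T^t* *m X)).
    by rewrite -pairing sum_enum; apply: eq_bigr => i _; rewrite /c enum_valK.
  have p2 : \sum_(i < #|K|) x_ X (enum_val i) *: e (enum_val i) = X.
    by apply: etrans (decomp X); rewrite sum_enum.
  move=> yr; have := dom (fun s => match s with inl j => y j | inr i => x_ X (enum_val i) end).
  by rewrite !big_sumType /= p1 p2; apply=> -[].
exists T; split=> [X|j].
  have := dom' (fun=> 0) X; rewrite !big1 ?add0r => [|j _|j _]; rewrite ?mul0r ?scale0r //.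
  by apply.
have sum1 (s : C) : \sum_i (if i == j then s else 0) * a i = s * a j /\
    \sum_i (if i == j then s else 0) *: v i = s *: v j.
  rewrite (bigD1 j) //= [X in _ /\ X = _](bigD1 j) //= eqxx !big1 ?addr0 // => i /negbTE ->.
    by rewrite scale0r.
  by rewrite mul0r.
(* Domination at a combination equal to 0; the cases [s = 1] and [s = -1] show that the extension
   takes the value [a j] at [v j]. *)
have zero_le (s : C) : s \is Num.real -> s * a j + 'Re (\tr (T^t* *m (- s *: v j))) <= 0.
  move=> sr; have := dom' (fun i => if i == j then s else 0) (- s *: v j).
  have [-> ->] := sum1 s; rewrite scaleNr subrr (kyfan0 _ kn); apply=> i.
  by case: ifP.
apply/eqP; rewrite eq_le; apply/andP; split.
  have := zero_le (-1); rewrite opprK scale1r mulN1r addrC subr_le0; apply.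
  by rewrite rpredN rpred1.
have := zero_le 1; rewrite scaleN1r mul1r mulmxN linearN /= raddfN subr_le0; apply; exact: rpred1.
Qed.
End SupportFunctional.

(** * Sufficiency of a certificate, and the functional given by orthogonality *)

Section Criterion.
Variables (C : numClosedFieldType) (n k : nat).
Hypothesis kn : (1 <= k <= n)%N.
Implicit Types (A X V S R M G H T : 'M[C]_n) (W : {vspace 'M[C]_n}).

(** All singular values are at most 1, so [X] lies in the dual ball for [k = n], where their sum is
    at most [n]. *)
Lemma opnorm_form_le X (x y : 'rV[C]_n) : opnorm X <= 1 ->
  (x *m x^t*) 0 0 = 1 -> (y *m y^t*) 0 0 = 1 -> `|(x *m X *m y^t*) 0 0| <= 1.
Proof.
move=> X1; have [S [V [Su Vu XE _]]] := svd X.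
have sv_le1 (i : 'I_n) : sv X i <= 1.
  by apply: le_trans X1; apply: sv_noninc; rewrite ltn_ord.
have [Xb _] : dual_ball n X.
  rewrite XE; apply: dual_ball_mul; rewrite ?trmxC_unitary //.
  apply: dual_ball_diag => [j|]; first by rewrite mxE sv_ge0 sv_le1.
  apply: (@le_trans _ _ (\sum_(j < n) 1)); last by rewrite sumr_const card_ord.
  by apply: ler_sum => j _; rewrite mxE sv_le1.
exact: Xb.
Qed.

Lemma psd_dual_ball X : psdmx X -> \tr X <= k%:R ->
  (forall x : 'rV[C]_n, (x *m x^t*) 0 0 = 1 -> (x *m X *m x^t*) 0 0 <= 1) ->
  dual_ball k X.
Proof.
move=> /psd_spectral[V [Vu d0 XE]] trX X1.
set d := spectral_diag X in d0 XE.
have dE : diag_mx d = V *m X *m V^t*.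
  by rewrite XE !mulmxA (unitarymxP Vu) mul1mx mulmxtVK.
rewrite XE; apply: dual_ball_mul; rewrite ?trmxC_unitary //.
apply: dual_ball_diag => [j|].
  rewrite d0 /=; have := X1 (row j V) (sqnorm_row_unitary j Vu).
  by rewrite -mulmx_row_entry -dE mxE eqxx mulr1n.
by apply: le_trans trX; rewrite -mxtrace_diag dE mxtrace_mulC mulmxA (unitarymxV Vu) mul1mx.
Qed.

Lemma dual_ball_opnorm m X : dual_ball m X -> opnorm X <= 1.
Proof.
move=> [X1 _]; have [S [V [Su Vu XE _]]] := svd X.
have /andP[k0 le_kn] := kn; pose i0 := Ordinal (leq_trans k0 le_kn).
have XE0 : (S *m X *m V^t*) i0 i0 = opnorm X.
  by rewrite {1}XE !mulmxA (unitarymxP Su) mul1mx mulmxtVK // !mxE eqxx mulr1n.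
have := X1 (row i0 S) (row i0 V) (sqnorm_row_unitary i0 Su) (sqnorm_row_unitary i0 Vu).
by rewrite -mulmx_row_entry XE0 ger0_norm ?sv_ge0.
Qed.

(** The sum [Q] of the [P i] is positive, bounded by 1 and of trace [k], so [Q U^*] lies in the dual
    ball; its pairing with [A + Y] loses [Y] and equals the norm of [A]. *)
Lemma certificate_kf_orth A U absA W : polar_decomp A U absA ->
  (exists P : 'I_k -> 'M[C]_n, (forall i, density (P i)) /\
     opnorm (\sum_(i < k) P i) <= 1 /\
     (forall i : 'I_k, absA *m P i = sv A i *: P i) /\
     in_orth W (U *m \sum_(i < k) P i)) -> kf_orth k A W.
Proof.
move=> [Uu [_ [_ AE]]] [P [Pd [Q1 [Ps UQ]]]] Y YW.
set Q := \sum_i P i in Q1 UQ.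
have Qh : Q^t* = Q.
  rewrite /Q raddf_sum /= raddf_sum; apply: eq_bigr => i _.
  by case: (Pd i) => -[].
have trQ : \tr Q = k%:R.
  rewrite /Q raddf_sum /= -[in RHS](card_ord k) -sumr_const; apply: eq_bigr => i _.
  by case: (Pd i).
have Qpsd : psdmx Q.
  split=> // v; rewrite /Q mulmx_sumr mulmx_suml summxE; apply: sumr_ge0 => i _.
  by case: (Pd i) => -[].
have Qform (x : 'rV[C]_n) : (x *m x^t*) 0 0 = 1 -> (x *m Q *m x^t*) 0 0 <= 1.
  move=> x1; apply: le_trans (opnorm_form_le Q1 x1 x1).
  by rewrite real_ler_norm // ger0_real //; case: Qpsd => _; apply.
have trQ_le : \tr Q <= k%:R by rewrite trQ.
have Qb := psd_dual_ball Qpsd trQ_le Qform.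
have := dual_ball_mul (unitarymx1 C n) (_ : U^t* \is unitarymx) Qb.
rewrite trmxC_unitary mul1mx => /(_ Uu) QUb.
have := kyfan_ge kn (A + Y) QUb; congr (_ <= _).
rewrite mulmxDr raddfD /=.
have -> : \tr (Q *m U^t* *m Y) = 0.
  have := UQ _ YW; rewrite /hs_inner /adjmx trmxC_mul Qh //.
have -> : Q *m U^t* *m A = Q *m absA.
  by rewrite {1}AE mulmxA -(mulmxA Q) (unitarymxV Uu) mulmx1.
rewrite addr0 mxtrace_mulC /Q mulmx_sumr raddf_sum /=.
have -> : \sum_(i < k) \tr (absA *m P i) = kyfan k A.
  apply: eq_bigr => i _; rewrite Ps mxtraceZ; case: (Pd i) => _ ->; exact: mulr1.
by rewrite ger0_norm // kyfan_ge0.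
Qed.

(** Prescribe the norm of [A] at [A] and 0 on the real spanning family [b i], ['i *: b i] of [W]. *)
Lemma orth_functional A W : kf_orth k A W -> exists T,
  [/\ forall X, 'Re (\tr (T^t* *m X)) <= kyfan k X,
      'Re (\tr (T^t* *m A)) = kyfan k A & in_orth W T].
Proof.
move=> AW; pose b (i : 'I_(\dim W)) : 'M[C]_n := (vbasis W)`_i.
have bW i : b i \in W by apply: vbasis_mem; apply: mem_nth; rewrite size_tuple.
pose v (s : 'I_1 + 'I_(\dim W) * bool) : 'M[C]_n := match s with
  inl _ => A | inr (i, s) => (if s then 1 else 'i) *: b i end.
pose a (s : 'I_1 + 'I_(\dim W) * bool) : C := if s is inl _ then kyfan k A else 0.
have dom : kyfan_dominated k v a.
  split=> [[s|[i s]]|y yr]; [by rewrite ger0_real ?kyfan_ge0|exact: real0|].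
  rewrite !big_sumType !big_ord1 /= [X in _ + X]big1 ?addr0; last by move=> i _; rewrite mulr0.
  set Y := (X in _ *: A + X).
  have YW : Y \in W.
    by apply: rpred_sum => -[i s] _; rewrite !rpredZ.
  have := yr (inl ord0); set t := y (inl ord0) => tr.
  (* For nonpositive [t] the left side is nonpositive; for positive [t] divide by [t] and use
     orthogonality. *)
  have [t_le0|t_gt0] := real_leP tr (real0 C).
    by apply: le_trans (kyfan_ge0 _ _); rewrite mulr_le0_ge0 // kyfan_ge0.
  have := AW (t^-1 *: Y) (rpredZ _ YW) => /(ler_wpM2l (ltW t_gt0)).
  by rewrite -[X in _ <= X -> _]kyfanZ // scalerDr scalerA divff ?gt_eqF // scale1r.
have [T [T1 T2]] := norming_functional kn dom.
exists T; split=> //; first exact: (T2 (inl ord0)).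
move=> Y /coord_vbasis ->; rewrite /hs_inner /adjmx mulmx_sumr raddf_sum big1 //= => i _.
rewrite -scalemxAr linearZ /=; suff -> : \tr (T^t* *m (vbasis W)`_i) = 0 by rewrite mulr0.
(* The value 0 at [b i] kills the real part of the trace, that at ['i *: b i] its imaginary part. *)
rewrite [LHS]Crect.
have := T2 (inr (i, true)); have := T2 (inr (i, false)); rewrite /v /a scale1r.
rewrite -scalemxAr linearZ /= ReMil => /eqP; rewrite oppr_eq0 => /eqP im0 re0.
by rewrite im0 re0 mulr0 addr0.
Qed.

End Criterion.

(** * Extremal weights and positivity of the support functional *)

Section Necessity.
Variables (C : numClosedFieldType) (n k : nat).
Hypothesis kn : (1 <= k <= n)%N.
Implicit Types (A X V S R M G H T : 'M[C]_n) (W : {vspace 'M[C]_n}).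

(** The equality case of [weighted_sum_le]: the deficit is the sum of the nonnegative quantities
    [e1 i], [e2 i] and [t (k - sum |c i|)], so all vanish. Since [t > 0], the last gives the total;
    [e2] fixes [c i] where [s i] differs from [t], and [e1] makes the weights nonnegative. *)
Lemma extremal_weights (s : nat -> C) (c : 'I_n -> C) (t := s k.-1) :
  (forall i j, (i <= j < n)%N -> s j <= s i) -> (forall i, 0 <= s i) -> 0 < t ->
  (forall i, c i \is Num.real) -> (forall i, `|c i| <= 1) -> \sum_i `|c i| <= k%:R ->
  \sum_(i < k) s i <= \sum_(i < n) s i * c i ->
  \sum_i c i = k%:R /\ forall i : 'I_n, (t < s i -> c i = 1) /\ (s i < t -> c i = 0).
Proof.
move=> sd s0 t0 cr c1 ck le_sc.
pose e1 (i : 'I_n) := s i * (`|c i| - c i).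
pose e2 (i : 'I_n) := (s i - t) * ((i < k)%:R - `|c i|).
have e1_ge0 i : 0 <= e1 i by rewrite mulr_ge0 // subr_ge0 real_ler_norm.
have e2_ge0 i : 0 <= e2 i.
  rewrite /e2; case: (ltnP i k) => ik; last first.
    rewrite sub0r mulrN -mulNr opprB mulr_ge0 // subr_ge0 sd //.
    by have := ltn_ord i; lia.
  by rewrite mulr_ge0 // subr_ge0 // sd //; lia.
have e3_ge0 : 0 <= t * (k%:R - \sum_i `|c i|) by rewrite mulr_ge0 ?subr_ge0 // ltW.
have sum_k (F : nat -> C) : \sum_(i < k) F i = \sum_(i < n) F i * (i < k)%:R.
  have /andP[_ le_kn] := kn.
  rewrite (big_ord_widen _ _ le_kn) big_mkcond; apply: eq_bigr => i _.
  by case: ifP; rewrite ?mulr1 ?mulr0.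
have total : \sum_i (e1 i + e2 i) + t * (k%:R - \sum_i `|c i|) =
    \sum_(i < k) s i - \sum_(i < n) s i * c i.
  have -> : k%:R = \sum_(i < n) (i < k)%:R :> C.
    have := sum_k (fun=> 1); rewrite sumr_const card_ord => ->.
    by apply: eq_bigr => i _; rewrite mul1r.
  rewrite -sumrB mulr_sumr sum_k -sumrB -big_split /=.
  by apply: eq_bigr => i _; rewrite /e1 /e2; ring.
have sum_ge0 : 0 <= \sum_i (e1 i + e2 i) by apply: sumr_ge0 => i _; rewrite addr_ge0.
have : \sum_i (e1 i + e2 i) + t * (k%:R - \sum_i `|c i|) == 0.
  by rewrite eq_le addr_ge0 // total subr_le0 le_sc.
rewrite paddr_eq0 // psumr_eq0 => [/andP[/allP e0 e3]|i _]; last by rewrite addr_ge0.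
have e_eq0 (i : 'I_n) : s i * (`|c i| - c i) = 0 /\ (s i - t) * ((i < k)%:R - `|c i|) = 0.
  have := e0 i (mem_index_enum i); rewrite /= paddr_eq0 //.
  by move=> /andP[/eqP h1 /eqP h2].
have small (i : 'I_n) : s i < t -> c i = 0.
  move=> st; have [_ /eqP] := e_eq0 i.
  rewrite mulf_eq0 subr_eq0 lt_eqF //= subr_eq0 => /eqP /esym.
  case: ltnP => [ik|_ /normr0_eq0 //].
  have : t <= s i by rewrite sd //; lia.
  by move=> /(lt_le_trans st); rewrite ltxx.
have c_norm (i : 'I_n) : `|c i| = c i.
  have [s_eq0|s_neq0] := eqVneq (s i) 0; first by rewrite small ?normr0 // s_eq0.
  have [/eqP + _] := e_eq0 i; rewrite mulf_eq0 (negbTE s_neq0) subr_eq0.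
  by move=> /eqP.
split.
  move: e3; rewrite mulf_eq0 gt_eqF //= subr_eq0 => /eqP->.
  by apply: eq_bigr => i _; rewrite c_norm.
move=> i; split=> [ts|]; last exact: small.
have [_ /eqP] := e_eq0 i.
rewrite mulf_eq0 subr_eq0 gt_eqF //= subr_eq0 c_norm => /eqP <-.
suff -> : (i < k)%N by [].
rewrite ltnNge; apply/negP => ki.
have : s i <= t by rewrite sd //; have := ltn_ord i; lia.
by move=> /(lt_le_trans ts); rewrite ltxx.
Qed.

Lemma trace_rank_one M (x : 'rV[C]_n) : \tr (M *m (x^t* *m x)) = (x *m M *m x^t*) 0 0.
Proof. by rewrite mulmxA mxtrace_mulC mulmxA trace_mx11. Qed.

(** The difference [Z = M - M^*] is skew-Hermitian, hence normal, and its quadratic form vanishes;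
    so do its eigenvalues. *)
Lemma real_form_hermitian M :
  (forall x : 'rV[C]_n, (x *m M *m x^t*) 0 0 \is Num.real) -> M^t* = M.
Proof.
move=> Mr; pose Z := M - M^t*.
have Zadj : Z^t* = - Z by rewrite /Z raddfB /= raddfB /= trmxCK opprB.
have Zform (x : 'rV[C]_n) : (x *m Z *m x^t*) 0 0 = 0.
  have form_adj : (x *m M^t* *m x^t*) 0 0 = ((x *m M *m x^t*) 0 0)^*.
    have -> : x *m M^t* *m x^t* = (x *m M *m x^t*)^t*.
      by rewrite !trmxC_mul trmxCK mulmxA.
    by rewrite !mxE.
  rewrite mulmxBr mulmxBl [LHS]mxE [X in _ + X]mxE form_adj.
  by rewrite (CrealP (Mr x)) subrr.
have Zn : Z \is normalmx by apply/normalmxP; rewrite Zadj mulmxN mulNmx.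
have Vu := spectral_unitarymx Z; have /orthomx_spectralP := Zn.
rewrite invmx_unitary //; set V := spectralmx Z in Vu *; set d := spectral_diag Z => ZE.
have d0 : d = 0.
  apply/rowP => i; rewrite mxE; have := Zform (row i V).
  rewrite -mulmx_row_entry {1}ZE !mulmxA (unitarymxP Vu) mul1mx mulmxtVK //.
  by rewrite mxE eqxx mulr1n.
move: ZE; rewrite d0 linear0 mulmx0 mul0mx => /eqP.
by rewrite subr_eq0 => /eqP <-.
Qed.

Lemma scale_form (x : 'rV[C]_n) M (a : C) :
  ((a *: x) *m M *m (a *: x)^t*) 0 0 = `|a| ^+ 2 * (x *m M *m x^t*) 0 0.
Proof.
by rewrite linearZ map_mxZ /= -!scalemxAl -scalemxAr scalerA mxE normCK.
Qed.

Lemma exists_normalize (x : 'rV[C]_n) : x != 0 -> exists2 a, 0 < a &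
  ((a *: x) *m (a *: x)^t*) 0 0 = 1.
Proof.
move=> x0; pose s := sqrtC ((x *m x^t*) 0 0).
have s0 : 0 < s by rewrite sqrtC_gt0 lt_def sqnorm_eq0 x0 sqnorm_ge0.
exists s^-1; first by rewrite invr_gt0.
have := scale_form x 1%:M s^-1; rewrite !mulmx1 => ->.
rewrite ger0_norm ?invr_ge0 ?ltW // -(sqrtCK ((x *m x^t*) 0 0)) -/s.
by rewrite -exprMn mulVf ?expr1n ?gt_eqF.
Qed.

(** [E = x^* x] is a Hermitian projection; the matrix is [w] on its range and 1 on the
    complement. *)
Lemma reflection_unitary (x : 'rV[C]_n) (w : C) : (x *m x^t*) 0 0 = 1 -> `|w| = 1 ->
  1%:M - (1 - w) *: (x^t* *m x) \is unitarymx.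
Proof.
move=> x1 w1; apply/unitarymxP.
set E := x^t* *m x.
have Eadj : E^t* = E by rewrite trmxC_mul trmxCK.
have EE : E *m E = E.
  by rewrite /E mulmxA -(mulmxA (x^t*)) [x *m x^t*]mx11_scalar x1 mulmx1.
have -> : (1%:M - (1 - w) *: E)^t* = 1%:M - (1 - w)^* *: E.
  rewrite raddfB /= raddfB /= trmx1 map_mx1 linearZ map_mxZ /=.
  by rewrite -/(E^t*) Eadj.
transitivity (1%:M + (- (1 - w)^* + ((1 - w) * (1 - w)^* - (1 - w))) *: E).
  rewrite mulmxBr mulmx1 mulmxBl mul1mx -scalemxAl -scalemxAr EE scalerA.
  move: (1 - w) => a; move: a^* => b.
  rewrite !scalerDl !scaleNr -addrA opprB; congr (_ + _).
  by rewrite addrCA [RHS]addrCA; congr (_ + _); apply: addrC.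
suff -> : - (1 - w)^* + ((1 - w) * (1 - w)^* - (1 - w)) = 0 by rewrite scale0r addr0.
have := normCK w; rewrite w1 expr1n rmorphB rmorph1 /= => ww.
have -> : - (1 - w^*) + ((1 - w) * (1 - w^*) - (1 - w)) = w * w^* - 1 by ring.
by rewrite -ww subrr.
Qed.

(* Testing against rank-one perturbations 1 - (1 - w) x^* x of the identity,
   with w x M x^* = |x M x^*|, shows that x M x^* is nonnegative. *)
Lemma support_functional_psd M : (forall X, 'Re (\tr (M *m X)) <= kyfan k X) ->
  'Re (\tr M) = k%:R ->
  psdmx M /\ forall x : 'rV[C]_n, (x *m x^t*) 0 0 = 1 -> (x *m M *m x^t*) 0 0 <= 1.
Proof.
move=> ML trM.
have form_unit (x : 'rV[C]_n) : (x *m x^t*) 0 0 = 1 -> 0 <= (x *m M *m x^t*) 0 0.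
  move=> x1; set z := (x *m M *m x^t*) 0 0.
  have [->//|z0] := eqVneq z 0.
  pose w := z^* / `|z|.
  have w1 : `|w| = 1 by rewrite normrM normfV normr_id norm_conjC divff // normr_eq0.
  have wz : w * z = `|z|.
    by rewrite /w mulrAC -[z^* * z]mulrC -normCK expr2 mulfK // normr_eq0.
  (* As [Re tr M] already equals [k], this bound leaves [|z| <= Re z], which forces [z] to be
     nonnegative. *)
  have := le_trans (ML _) (kyfan_unitary kn (reflection_unitary x1 w1)).
  rewrite mulmxBr mulmx1 -scalemxAr raddfB /= linearZ /= trace_rank_one -/z.
  rewrite raddfB /= trM gerDl oppr_le0 mulrBl mul1r wz raddfB /=.
  rewrite (Creal_ReP `|z| (normr_real _)) subr_ge0 => le_zRe.
  by rewrite -(ge_leif (leif_Re_Creal z)).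
have M_ge0 (x : 'rV[C]_n) : 0 <= (x *m M *m x^t*) 0 0.
  have [->|x0] := eqVneq x 0; first by rewrite !mul0mx mxE.
  have [a a0 /form_unit] := exists_normalize x0.
  by rewrite scale_form pmulr_rge0 // exprn_gt0 // normr_gt0 gt_eqF.
split; first by split=> //; apply: real_form_hermitian => x; rewrite ger0_real.
move=> x x1; have := le_trans (ML _) (kyfan_rank_one kn x1 x1).
by rewrite trace_rank_one (Creal_ReP _ (ger0_real (M_ge0 x))).
Qed.

(** In an eigenbasis [X i i] is a sum of nonnegative terms [d l |V l i|^2]; all vanish, and with
    them the terms of [X i j]. *)
Lemma psd_zero_diag X i j : psdmx X -> X i i = 0 -> X i j = 0.
Proof.
move=> /psd_spectral[V [Vu d0 XE]] Xii; set d := spectral_diag X in d0 XE.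
have dV l : d 0 l * `|V l i| ^+ 2 = 0.
  have : \sum_l d 0 l * `|V l i| ^+ 2 = 0.
    apply: etrans Xii; rewrite {1}XE mul_diag_entry; apply: eq_bigr => m _.
    by rewrite !mxE normCK [_^* * _]mulrC.
  move=> /eqP; rewrite psumr_eq0 => [/allP/(_ l (mem_index_enum l))/eqP //|m _].
  by rewrite mulr_ge0 ?exprn_ge0.
rewrite XE mul_diag_entry big1 // => l _; rewrite !mxE.
have /eqP := dV l; rewrite mulf_eq0 expf_eq0 normr_eq0 /= => /orP[/eqP->|/eqP->].
  by rewrite mul0r.
by rewrite rmorph0 mul0r mulr0.
Qed.

End Necessity.

(** * Construction of the density matrices *)

Section Certificate.
Variables (C : numClosedFieldType) (n k : nat).
Hypothesis kn : (1 <= k <= n)%N.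
Implicit Types (A X V S R M G H T : 'M[C]_n) (W : {vspace 'M[C]_n}).

Lemma psd_diag (d : 'rV[C]_n) : (forall i, 0 <= d 0 i) -> psdmx (diag_mx d).
Proof.
move=> d0; split.
  apply/matrixP => i j; rewrite !mxE eq_sym rmorphMn /=.
  by case: eqP => [->|//]; rewrite !mulr1n; apply/CrealP/ger0_real.
move=> v; rewrite mul_diag_entry; apply: sumr_ge0 => l _.
by rewrite !mxE mulr_ge0 // mul_conjC_ge0.
Qed.

Lemma psd_conj X V : psdmx X -> psdmx (V^t* *m X *m V).
Proof.
move=> [Xh X0]; split.
  by rewrite /adjmx !trmxC_mul trmxCK mulmxA; move: Xh; rewrite /adjmx => ->.
by move=> v; have := X0 (v *m V^t*); rewrite trmxC_mul trmxCK !mulmxA.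
Qed.

Lemma psd_scale (a : C) X : 0 <= a -> psdmx X -> psdmx (a *: X).
Proof.
move=> a0 [Xh X0]; split.
  rewrite /adjmx linearZ map_mxZ /= (CrealP (ger0_real a0)).
  by move: Xh; rewrite /adjmx => ->.
by move=> v; rewrite -scalemxAr -scalemxAl mxE mulr_ge0.
Qed.

Lemma psd_complement T : psdmx T ->
  (forall x : 'rV[C]_n, (x *m x^t*) 0 0 = 1 -> (x *m T *m x^t*) 0 0 <= 1) ->
  psdmx (1%:M - T).
Proof.
move=> [Th T0] T1; split.
  rewrite /adjmx raddfB /= raddfB /= trmx1 map_mx1.
  by move: Th; rewrite /adjmx => ->.
move=> v; have [->|v0] := eqVneq v 0; first by rewrite !mul0mx mxE.
have [a a0 av1] := exists_normalize v0; have := T1 _ av1.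
rewrite -[X in _ <= X -> _]av1 -[X in _ <= (X *m _) 0 0 -> _]mulmx1.
rewrite !scale_form ler_pM2l; last first.
  by rewrite exprn_gt0 // normr_gt0 gt_eqF.
suff -> : (v *m (1%:M - T) *m v^t*) 0 0 = (v *m 1%:M *m v^t*) 0 0 - (v *m T *m v^t*) 0 0.
  by rewrite subr_ge0.
by rewrite mulmxBr mulmxBl [LHS]mxE [X in _ + X]mxE.
Qed.

(** [T] is the identity on coordinates with [s i > t], zero on those with [s i < t], and a block [Q]
    on those with [s i = t]. The indices above [t] receive their coordinate projections; the others
    below [k] share [Q] equally. *)
Lemma spectral_pieces (s : nat -> C) T (t := s k.-1) :
  (forall i j, (i <= j < n)%N -> s j <= s i) -> (forall i, 0 <= s i) ->
  psdmx T -> (forall x : 'rV[C]_n, (x *m x^t*) 0 0 = 1 -> (x *m T *m x^t*) 0 0 <= 1) ->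
  \tr T = k%:R ->
  (forall i : 'I_n, (t < s i -> T i i = 1) /\ (s i < t -> T i i = 0)) ->
  exists P : 'I_k -> 'M[C]_n, [/\ forall i, density (P i), \sum_i P i = T &
    forall i : 'I_k, diag_of_nat n s *m P i = s i *: P i].
Proof.
move=> sd s0 Tpsd T1 trT Tdiag; have /andP[k0 le_kn] := kn.
have sr i : s i \is Num.real by apply: ger0_real.
have tr : t \is Num.real := sr _.
pose big i := t < s i.
have big_row (i l : 'I_n) : big i -> T i l = (i == l)%:R.
  move=> /(proj1 (Tdiag i)) Tii; apply/esym/eqP; rewrite -subr_eq0.
  have := @psd_zero_diag _ _ (1%:M - T) i l (psd_complement Tpsd T1).
  by rewrite !mxE eqxx Tii subrr => -> //.
have big_col (i l : 'I_n) : big l -> T i l = (i == l)%:R.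
  move=> bl; have [/matrixP/(_ i l) + _] := Tpsd; rewrite !mxE => <-.
  by rewrite big_row // eq_sym rmorph_nat.
have small_row (i l : 'I_n) : s i < t -> T i l = 0.
  by move=> /(proj2 (Tdiag i)); apply: psd_zero_diag.
have big_lt i : (i < n)%N -> big i -> (i < k)%N.
  move=> ltin bi; rewrite ltnNge; apply/negP => ki.
  have : s i <= t by rewrite sd //; lia.
  by move=> /(lt_le_trans bi); rewrite ltxx.
pose pr : 'rV[C]_n := \row_(i < n) (~~ big i)%:R.
pose Q := diag_mx pr *m T *m diag_mx pr.
have QE i j : Q i j = T i j - (big i)%:R *+ (i == j).
  rewrite /Q mul_mx_diag mul_diag_mx !mxE.
  have [bi|nbi] := boolP (big i).
    by rewrite big_row // !mul0r /= subrr.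
  have [bj|nbj] := boolP (big j); last by rewrite mul1r mulr1 mul0rn subr0.
  by rewrite big_col // mulr0 mul0rn subr0; case: eqP nbi => // ->; rewrite bj.
have Qpsd : psdmx Q.
  have -> : Q = (diag_mx pr)^t* *m T *m diag_mx pr.
    suff [] : psdmx (diag_mx pr) by rewrite /adjmx => ->.
    by apply: psd_diag => i; rewrite mxE ler0n.
  exact: psd_conj.
(* The number of indices below [k] with [s i = t]. It is positive because [k - 1] is one of them,
   and it is the trace of [Q]. *)
pose m : C := \sum_(i < k) (~~ big i)%:R.
have m_gt0 : 0 < m.
  have ltk : (k.-1 < k)%N by rewrite prednK.
  rewrite /m (bigD1 (Ordinal ltk)) //= {1}/big ltxx /= ltr_pwDl ?ltr01 //.
  by apply: sumr_ge0 => i _; rewrite ler0n.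
have trQ : \tr Q = m.
  rewrite /mxtrace; under eq_bigr do rewrite QE eqxx mulr1n.
  rewrite sumrB -/(\tr T) trT.
  have -> : \sum_(i < n) (big i)%:R = \sum_(i < k) (big i)%:R :> C.
    rewrite (big_ord_widen _ (fun i => (big i)%:R) le_kn) [RHS]big_mkcond.
    apply: eq_bigr => i _; case: ifP => // /negbT ki.
    by case: (boolP (big i)) => // /(big_lt _ (ltn_ord i)); rewrite (negbTE ki).
  have -> : k%:R = \sum_(i < k) 1 :> C by rewrite sumr_const card_ord.
  by rewrite -sumrB; apply: eq_bigr => i _; case: (big i); rewrite ?subrr ?subr0.
pose E (i : nat) : 'M[C]_n := diag_mx (\row_(l < n) (l == i :> nat)%:R).
pose P (i : 'I_k) := if big i then E i else m^-1 *: Q.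
exists P; split=> [i||i].
- rewrite /P; case: ifP => _; split.
  + by apply: psd_diag => l; rewrite mxE ler0n.
  + rewrite mxtrace_diag (bigD1 (widen_ord le_kn i)) //= mxE eqxx big1 ?addr0 // => l li.
    by rewrite mxE; move: li; rewrite -val_eqE /= => /negbTE ->.
  + by apply: psd_scale => //; rewrite invr_ge0 ltW.
  + by rewrite mxtraceZ trQ mulVf // gt_eqF.
- apply/matrixP => a b; rewrite summxE.
  have PE (i : 'I_k) : P i a b =
      (big i && (a == i :> nat))%:R *+ (a == b) + (~~ big i)%:R * (m^-1 * Q a b).
    rewrite /P; case: ifP => _; last by rewrite mxE mul1r mul0rn add0r.
    by rewrite !mxE mul0r addr0.
  have mQ : m * (m^-1 * Q a b) = Q a b by rewrite mulVKf // gt_eqF.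
  under eq_bigr do rewrite PE.
  rewrite big_split /= -mulr_suml -/m mQ QE sumrMnl.
  suff -> : \sum_(i < k) (big i && (a == i :> nat))%:R = (big a)%:R :> C by rewrite addrC subrK.
  have [ak|ka] := ltnP a k.
    rewrite (bigD1 (Ordinal ak)) //= eqxx andbT big1 ?addr0 // => i.
    by rewrite -val_eqE /= eq_sym => /negbTE ->; rewrite andbF.
  rewrite big1 => [|i _].
    by case: (boolP (big a)) => // /(big_lt _ (ltn_ord a)); rewrite ltnNge ka.
  by rewrite gtn_eqF ?andbF // (leq_trans (ltn_ord i)).
apply/matrixP => a b; rewrite mul_diag_mx !mxE /P; case: ifP => bi.
  rewrite !mxE; case: eqP => [->//|_]; first by rewrite mul0rn !mulr0.
have sit : s i = t.
  have ti : t <= s i by rewrite sd //; have := ltn_ord i; lia.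
  by move: bi => /negbT; rewrite -real_leNgt // => it; apply/eqP; rewrite eq_le ti it.
(* Rows of [Q] vanish above [t] by the cut and below [t] by [small_row]; on the others the
   eigenvalue is [t]. *)
rewrite [(_ *: Q) _ _]mxE QE sit; have [ba|] := boolP (big a).
  by rewrite big_row // subrr !mulr0.
rewrite /big -real_leNgt // le_eqVlt => /predU1P[->//|st].
by rewrite small_row // mul0rn subr0 !mulr0.
Qed.

(** In the eigenbasis [V] of [absA], the functional becomes a matrix [M] that is norming for the
    diagonal matrix of singular values; cut [M] into pieces and transport them back. *)
Lemma kf_orth_certificate A U absA W : polar_decomp A U absA -> 0 < sv A k.-1 ->
  kf_orth k A W -> exists P : 'I_k -> 'M[C]_n,
    (forall i, density (P i)) /\
    opnorm (\sum_(i < k) P i) <= 1 /\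
    (forall i : 'I_k, absA *m P i = sv A i *: P i) /\
    in_orth W (U *m \sum_(i < k) P i).
Proof.
move=> [Uu [absA_psd [absA2 AE]]] sk_gt0 /(orth_functional kn)[T [T_le T_A T_W]].
have [_ [V [_ Vu _ gramE]]] := svd A.
rewrite -absA2 in gramE.
have absAE := psd_sqrt_diag Vu absA_psd (sv_ge0 A) gramE.
have [M ME] : exists M, M = V *m (T^t* *m U) *m V^t* by exists (V *m (T^t* *m U) *m V^t*).
have trM X : \tr (M *m X) = \tr (T^t* *m (U *m (V^t* *m X *m V))).
  by rewrite ME -!mulmxA mxtrace_mulC !mulmxA.
have M_le X : 'Re (\tr (M *m X)) <= kyfan k X.
  rewrite trM; apply: le_trans (T_le _) _.
  rewrite kyfan_unitary_mul //; apply: le_trans (kyfan_mulr_le kn _ Vu) _.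
  by rewrite kyfan_unitary_mul ?trmxC_unitary.
have M_A : 'Re (\tr (M *m diag_of_nat n (sv A))) = kyfan k A by rewrite trM -absAE -AE.
pose c i := 'Re (M i i).
(* With these signs, the diagonal unitary bounds the sum of the [|c i|] by [k], and signed rank-one
   matrices bound each [|c i|] by 1. *)
pose eps (i : 'I_n) : C := if 0 <= c i then 1 else -1.
have eps_conj i : (eps i)^* = eps i.
  by rewrite /eps; case: ifP => _; rewrite ?rmorphN1 ?rmorph1.
have eps_sqr i : eps i * eps i = 1.
  by rewrite /eps; case: ifP => _; rewrite ?mulrNN mulr1.
have eps_real i : eps i \is Num.real by apply/CrealP.
have c_real i : c i \is Num.real := Creal_Re _.
have eps_c i : eps i * c i = `|c i|.
  rewrite /eps; case: ifP => [ci|/negbT]; first by rewrite mul1r ger0_norm.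
  by rewrite -real_ltNge // => ci; rewrite mulN1r ltr0_norm.
have Re_trace_diag (d : 'I_n -> C) : (forall i, d i \is Num.real) ->
    'Re (\tr (M *m diag_mx (\row_i d i))) = \sum_i d i * c i.
  move=> dr; rewrite raddf_sum /=; apply: eq_bigr => i _.
  by rewrite mul_mx_diag !mxE ReMr // mulrC.
have c_sum : \sum_i `|c i| <= k%:R.
  have Eu : diag_mx (\row_i eps i) \is unitarymx.
    apply/unitarymxP/matrixP => i j; rewrite mul_diag_mx !mxE rmorphMn /= eps_conj.
    by rewrite [j == i]eq_sym; case: eqP => [->|_]; rewrite ?mulr0 // mulr1n eps_sqr.
  have := le_trans (M_le _) (kyfan_unitary kn Eu); rewrite Re_trace_diag //.
  by under eq_bigr do rewrite eps_c.
have c_le1 i : `|c i| <= 1.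
  pose x : 'rV[C]_n := row i 1%:M.
  have x1 : (x *m x^t*) 0 0 = 1 by apply/sqnorm_row_unitary/unitarymx1.
  have xM : (x *m M *m x^t*) 0 0 = M i i.
    by rewrite -mulmx_row_entry trmx1 map_mx1 mul1mx mulmx1.
  have ex1 : ((eps i *: x) *m (eps i *: x)^t*) 0 0 = 1.
    have := scale_form x 1%:M (eps i); rewrite !mulmx1 => ->.
    by rewrite x1 mulr1 normCK eps_conj eps_sqr.
  have := le_trans (M_le _) (kyfan_rank_one kn x1 ex1).
  rewrite mulmxA mxtrace_mulC mulmxA trace_mx11.
  rewrite linearZ map_mxZ /= -scalemxAr mxE eps_conj xM ReMl //.
  by rewrite -/(c i) eps_c.
have sc : \sum_(i < k) sv A i <= \sum_(i < n) sv A i * c i.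
  rewrite -[leLHS]/(kyfan k A) -M_A Re_trace_diag // => i.
  exact/ger0_real/sv_ge0.
have [c_k c_ext] := extremal_weights kn (@sv_noninc _ _ A) (sv_ge0 A) sk_gt0
  c_real c_le1 c_sum sc.
have ReM_k : 'Re (\tr M) = k%:R by rewrite raddf_sum.
have [Mpsd M1] := support_functional_psd kn M_le ReM_k.
have M_diag i : M i i = c i.
  have := proj2 Mpsd (row i 1%:M).
  rewrite -mulmx_row_entry trmx1 map_mx1 mul1mx mulmx1.
  by move=> /ger0_real/Creal_ReP h; rewrite /c h.
have trM_k : \tr M = k%:R by rewrite -c_k; apply: eq_bigr => i _.
have [|P' [P'd P'M P's]] := spectral_pieces (@sv_noninc _ _ A) (sv_ge0 A) Mpsd M1 trM_k.
  by move=> i; rewrite M_diag; apply: c_ext.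
have sumP : \sum_i V^t* *m P' i *m V = V^t* *m M *m V.
  by rewrite -mulmx_suml -mulmx_sumr P'M.
exists (fun i => V^t* *m P' i *m V); rewrite sumP; split; [|split; [|split]].
- move=> i; case: (P'd i) => Pi_psd Pi_tr; split; first exact: psd_conj.
  by rewrite mxtrace_mulC mulmxA (unitarymxP Vu) mul1mx.
- apply: (dual_ball_opnorm kn (m := k)); apply: dual_ball_mul; rewrite ?trmxC_unitary //.
  by apply: psd_dual_ball => //; rewrite trM_k.
- move=> i; rewrite absAE !mulmxA mulmxtVK //.
  by rewrite -(mulmxA (V^t*)) P's -scalemxAr -scalemxAl.
have [Mh _] := Mpsd.
(* As [M] is Hermitian, this matrix also equals [U^* T], so [U] times the sum of the pieces is [T],
   which is orthogonal to [W]. *)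
have VMV : V^t* *m M *m V = T^t* *m U.
  by rewrite ME !mulmxA (unitarymxV Vu) mul1mx -!mulmxA (unitarymxV Vu) mulmx1.
have -> : V^t* *m M *m V = U^t* *m T.
  have <- : (T^t* *m U)^t* = U^t* *m T by rewrite trmxC_mul trmxCK.
  by rewrite -VMV !trmxC_mul trmxCK mulmxA; move: Mh; rewrite /adjmx => ->.
by rewrite mulmxA (unitarymxP Uu) mul1mx.
Qed.

End Certificate.

Unset Implicit Arguments.

Theorem theorem1p3 (C : numClosedFieldType) (n k : nat) (A U absA : 'M[C]_n)
  (W : {vspace 'M[C]_n}) :
  (1 <= k)%N -> (k <= n)%N -> polar_decomp A U absA ->
  ((exists P : 'I_k -> 'M[C]_n,
      (forall i, density (P i)) /\
      opnorm (\sum_(i < k) P i) <= 1 /\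
      (forall i : 'I_k, absA *m P i = sv A i *: P i) /\
      in_orth W (U *m \sum_(i < k) P i))
    -> kf_orth k A W)
  /\
  (0 < sv A k.-1 -> kf_orth k A W ->
    exists P : 'I_k -> 'M[C]_n,
      (forall i, density (P i)) /\
      opnorm (\sum_(i < k) P i) <= 1 /\
      (forall i : 'I_k, absA *m P i = sv A i *: P i) /\
      in_orth W (U *m \sum_(i < k) P i)).
Proof.
move=> k_gt0 le_kn polar; have kn : (1 <= k <= n)%N by rewrite k_gt0.
split=> [cert|sk_gt0 orth]; first exact: certificate_kf_orth kn _ _ _ _ polar cert.
exact: kf_orth_certificate kn _ _ _ _ polar sk_gt0 orth.
Qed.
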